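(* Let $M$ be a manifold and $\varphi:M\to M$ a diffeomorphism. For $x,y\in\Gamma(\varphi^!TM)$ put $$[x,y]_{\varphi^*}=\varphi^*\circ x\circ(\varphi^* )^{-1}\circ y\circ(\varphi^* )^{-1}-\varphi^*\circ y\circ(\varphi^* )^{-1}\circ x\circ(\varphi^* )^{-1},\qquad \mathrm{Ad}_{\varphi^*}(x)=\varphi^*\circ x\circ(\varphi^* )^{-1}.$$ Then $(\varphi^!TM,\varphi,\mathrm{Ad}_{\varphi^*},[\cdot,\cdot]_{\varphi^*},\mathrm{id})$ is a Hom-Lie algebroid.
   Context: Manifolds, bundles and maps are smooth; functions are real-valued. A Hom-Lie algebra $(\mathfrak g,[\cdot,\cdot],\phi)$ is a vector space with a skew-symmetric bilinear bracket and a linear map $\phi$ such that $\phi[x,y]=[\phi(x),\phi(y)]$ and $[\phi(x),[y,z]]+[\phi(y),[z,x]]+[\phi(z),[x,y]]=0$. A representation of it on a vector space $V$ with respect to $\beta\in\mathfrak{gl}(V)$ is a linear map $\rho:\mathfrak g\to\mathfrak{gl}(V)$ with $\rho(\phi(x))\circ\beta=\beta\circ\rho(x)$ and $\rho([x,y])\circ\beta=\rho(\phi(x))\circ\rho(y)-\rho(\phi(y))\circ\rho(x)$. For $\varphi:M\to M$, $\varphi^*f=f\circ\varphi$. A Hom-bundle $(A\to M,\varphi,\phi_A)$ is a vector bundle $A\to M$ with a smooth map $\varphi:M\to M$ and a linear map $\phi_A:\Gamma(A)\to\Gamma(A)$ such that $\phi_A(fx)=\varphi^*(f)\phi_A(x)$.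 $\varphi^!TM$ is the pullback bundle of $TM$; a section $x$ acts on functions by $x(f)(m)=x_m(f)$, where $x_m\in T_{\varphi(m)}M$. When $\varphi$ is a diffeomorphism, $\Gamma(\varphi^!TM)$ is thereby identified with the set of $(\varphi^*,\varphi^* )$-derivations of $C^\infty(M)$, i.e. linear maps $x$ with $x(fg)=x(f)\varphi^*(g)+\varphi^*(f)x(g)$. A Hom-Lie algebroid $(A,\varphi,\phi_A,[\cdot,\cdot]_A,a_A)$ is a Hom-bundle $(A\to M,\varphi,\phi_A)$ with a Hom-Lie algebra structure $(\Gamma(A),[\cdot,\cdot]_A,\phi_A)$ and a bundle map $a_A:A\to\varphi^!TM$ (anchor) such that (i) $[x,fy]_A=\varphi^*(f)[x,y]_A+a_A(\phi_A(x))(f)\,\phi_A(y)$ for $x,y\in\Gamma(A)$, $f\in C^\infty(M)$; (ii) $a_A$ is a representation of $(\Gamma(A),[\cdot,\cdot]_A,\phi_A)$ on $C^\infty(M)$ with respect to $\varphi^*$. *)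

(* Defs.v *)
From HB Require Import structures.
From mathcomp Require Import all_boot all_order all_algebra.
From mathcomp Require Import all_classical reals topology normedtype landau derive.

Set Implicit Arguments.
Unset Strict Implicit.
Unset Printing Implicit Defensive.

Import Order.TTheory GRing.Theory Num.Theory.
Import numFieldNormedType.Exports.

Local Open Scope classical_set_scope.
Local Open Scope ring_scope.

Section SmoothRn.
Context {R : realType}.

(* [S] is meant to be an open subset of R^n. *)
Fixpoint Ck {n : nat} (k : nat) (S : set 'rV[R]_n) (f : 'rV[R]_n -> R) : Prop :=
  if k is k'.+1 then
    (forall z, S z -> differentiable f z) /\
    (forall v : 'rV[R]_n, Ck k' S ('D_v f))
  else forall z, S z -> {for z, continuous f}.

Definition smooth_on {n : nat} (S : set 'rV[R]_n) (f : 'rV[R]_n -> R) : Prop :=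
  forall k, Ck k S f.

Definition smooth_map_on {n p : nat} (S : set 'rV[R]_n)
    (g : 'rV[R]_n -> 'rV[R]_p) : Prop :=
  forall j, smooth_on S (fun z => g z ord0 j).

Section Rn.
Context {n : nat}.
Implicit Types (S T : set 'rV[R]_n) (f g : 'rV[R]_n -> R).

Lemma near_eq_differentiable f g z :
  (\near z, f z = g z) -> differentiable f z -> differentiable g z.
Proof.
move=> fg /diff_locallyP[dc df].
have fgz : f z = g z := nbhs_singleton fg.
have dg : g \o shift z = cst (g z) + 'd f z +o_ 0 id.
  move/eqaddoP : df => df; apply/eqaddoP => e e0.
  have fg0 : \forall h \near 0, f (h + z) = g (h + z).
    by have := fg; rewrite (near_shift 0) subr0.
  near=> h.
  have -> : (g \o shift z - (cst (g z) + 'd f z)) h =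
            (f \o shift z - (cst (f z) + 'd f z)) h.
    by rewrite !fctE /= -fgz (near fg0 h).
  by near: h; exact: df.
apply/diff_locallyP.
by rewrite (diff_unique dc dg).
Unshelve. all: by end_near. Qed.

Lemma near_open S f g z : open S -> S z -> {in S, f =1 g} -> \near z, f z = g z.
Proof.
move=> oS Sz fg; near=> y; apply: fg; rewrite inE; near: y.
exact: open_nbhs_nbhs.
Unshelve. all: by end_near. Qed.

Lemma Ck_eq k S f g : open S -> {in S, f =1 g} -> Ck k S f -> Ck k S g.
Proof.
move=> oS; elim: k f g => [|k IH] f g fg /=.
  move=> cf z Sz; have fgz := near_open oS Sz fg.
  have fgE : f z = g z := nbhs_singleton fgz.
  have : f @ z --> g z by rewrite -fgE; exact: cf.
  move=> fgz'; apply: (cvg_trans _ fgz').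
  exact: (near_eq_cvg fgz).
move=> [df Df]; split=> [z Sz|v].
  exact: near_eq_differentiable (near_open oS Sz fg) (df z Sz).
apply: IH (Df v) => z; rewrite inE => Sz.
exact/near_eq_derive/(near_open oS Sz fg).
Qed.

Lemma smooth_on_eq S f g : open S -> {in S, f =1 g} ->
  smooth_on S f -> smooth_on S g.
Proof. by move=> oS fg sf k; apply: Ck_eq (sf k). Qed.

Lemma Ck_local k S f :
  (forall z, S z -> exists2 T, T z & Ck k T f) -> Ck k S f.
Proof.
elim: k f => [|k IH] f /= H.
  by move=> z /H[T Tz]; apply.
split=> [z /H[T Tz [df _]]|v]; first exact: df.
by apply: IH => z /H[T Tz [_ Df]]; exists T.
Qed.

Lemma smooth_on_local S f :
  (forall z, S z -> exists2 T, T z & smooth_on T f) -> smooth_on S f.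
Proof. by move=> H k; apply: Ck_local => z /H[T Tz sT]; exists T. Qed.

Lemma smooth_on_sub S T f : S `<=` T -> smooth_on T f -> smooth_on S f.
Proof. by move=> ST sT; apply: smooth_on_local => z /ST Tz; exists T. Qed.

Lemma CkS k S f : Ck k.+1 S f -> Ck k S f.
Proof.
elim: k f => [|k IH] f [df Df].
  by move=> z Sz; exact/differentiable_continuous/df.
by split=> // v; apply: IH.
Qed.

Lemma Ck_cst k S (c : R) : Ck k S (cst c).
Proof.
elim: k c => [|k IH] c; first by move=> z _; apply: cst_continuous.
split=> [z _|v]; first exact: differentiable_cst.
by rewrite (_ : (fun z => _) = cst 0)//; apply/funext => z; rewrite derive_cst.
Qed.

Lemma smooth_on_cst S (c : R) : smooth_on S (cst c).
Proof. by move=> k; exact: Ck_cst. Qed.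

Lemma Ck_add k S f g : open S -> Ck k S f -> Ck k S g -> Ck k S (f + g).
Proof.
move=> oS; elim: k f g => [|k IH] f g.
  by move=> cf cg z Sz; apply: continuousD; [exact (cf z Sz)|exact (cg z Sz)].
move=> [df Df] [dg Dg]; split=> [z Sz|v].
  by apply: differentiableD; [exact: df|exact: dg].
apply: (Ck_eq oS) (IH _ _ (Df v) (Dg v)) => z; rewrite inE => Sz.
by rewrite deriveD//; apply: diff_derivable; [exact: df|exact: dg].
Qed.

Lemma Ck_mul k S f g : open S -> Ck k S f -> Ck k S g -> Ck k S (f * g).
Proof.
move=> oS; elim: k f g => [|k IH] f g.
  by move=> cf cg z Sz; apply: continuousM; [exact (cf z Sz)|exact (cg z Sz)].
move=> Cf Cg; have [[df Df] [dg Dg]] := (Cf, Cg); split=> [z Sz|v].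
  by apply: differentiableM; [exact: df|exact: dg].
have := Ck_add oS (IH _ _ (CkS Cf) (Dg v)) (IH _ _ (CkS Cg) (Df v)).
apply: (Ck_eq oS) => z; rewrite inE => Sz.
by rewrite deriveM//; apply: diff_derivable; [exact: df|exact: dg].
Qed.

Lemma Ck_sum k S (I : eqType) (r : seq I) (F : I -> 'rV[R]_n -> R) : open S ->
  (forall i, i \in r -> Ck k S (F i)) -> Ck k S (fun z => \sum_(i <- r) F i z).
Proof.
move=> oS; elim: r => [|i r IH] H.
  by under eq_fun do rewrite big_nil; exact: Ck_cst.
under eq_fun do rewrite big_cons; apply: (Ck_add oS (H i _) (IH _)).
  by rewrite inE eqxx.
by move=> j jr; apply: H; rewrite inE jr orbT.
Qed.

End Rn.

Lemma continuous_row {T : topologicalType} {p : nat} (g : T -> 'rV[R]_p) z :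
  (forall j, {for z, continuous (fun z => g z ord0 j)}) ->
  {for z, continuous g}.
Proof.
move=> cg A [P Pnbhs PA].
have H : \forall w \near z, forall j, P ord0 j (g w ord0 j).
  apply: filter_forall => j; exact: (cg j _ (Pnbhs ord0 j)).
by apply: filterS H => w Hw; apply: PA => i j; rewrite ord1.
Qed.

Lemma differentiable_row {n p : nat} (g : 'rV[R]_n -> 'rV[R]_p) z :
  (forall j, differentiable (fun z => g z ord0 j) z) -> differentiable g z.
Proof.
move=> dg.
have -> : g = fun z => \sum_(j < p) (g z ord0 j) *: delta_mx ord0 j.
  by apply/funext => y; rewrite -row_sum_delta.
have -> : (fun z => \sum_(j < p) (g z ord0 j) *: delta_mx ord0 j : 'rV[R]_p) =
    \sum_(j < p) (fun z => (g z ord0 j) *: delta_mx ord0 j).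
  by apply/funext => y; rewrite fct_sumE.
by apply: differentiable_sum => j; apply: differentiableZl.
Qed.

Lemma derive_coord {n p : nat} (g : 'rV[R]_n -> 'rV[R]_p) z v j :
  differentiable g z -> 'D_v (fun z => g z ord0 j) z = ('D_v g z) ord0 j.
Proof.
move=> dg.
by rewrite derive_mx ?mxE//; apply: diff_derivable.
Qed.

Lemma Ck_comp {n p : nat} k (S : set 'rV[R]_n) (T : set 'rV[R]_p)
    (g : 'rV[R]_n -> 'rV[R]_p) (f : 'rV[R]_p -> R) :
  open S -> (forall z, S z -> T (g z)) ->
  (forall j, Ck k S (fun z => g z ord0 j)) -> Ck k T f -> Ck k S (f \o g).
Proof.
move=> oS ST; elim: k f => [|k IH] f Cg Cf.
  move=> z Sz; apply: (@continuous_comp _ _ _ g f); last exact/Cf/ST.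
  by apply: continuous_row => j; exact: Cg.
have dg z : S z -> differentiable g z.
  by move=> Sz; apply: differentiable_row => j; exact: (Cg j).1.
have [df Df] := Cf; split=> [z Sz|v].
  by apply: differentiable_comp; [exact: dg|exact/df/ST].
have : Ck k S (fun z => \sum_(j < p)
   ('D_(delta_mx ord0 j) f \o g) z * 'D_v (fun z => g z ord0 j) z).
  apply: Ck_sum => // j _; apply: (Ck_mul oS); last exact: (Cg j).2.
  by apply: IH => [i|]; [exact: CkS|exact: Df].
apply: (Ck_eq oS) => z; rewrite inE => Sz.
have dfg := df _ (ST _ Sz).
rewrite [RHS]deriveE; last exact: differentiable_comp (dg _ Sz) dfg.
rewrite diff_comp//; last exact: dg.
rewrite /= -(deriveE _ (dg _ Sz)) [in RHS](row_sum_delta ('D_v g z)) linear_sum.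
apply: eq_bigr => j _.
rewrite [RHS]linearZ -(deriveE _ dfg) (derive_coord v j (dg _ Sz)).
exact: mulrC.
Qed.
End SmoothRn.

Section Manifolds.
Context {R : realType}.

Record chart (n : nat) (T : topologicalType) := Chart {
  chart_dom : set T;
  chart_cod : set 'rV[R]_n;
  chart_map :> T -> 'rV[R]_n;
  chart_inv : 'rV[R]_n -> T;
  chart_dom_open : open chart_dom;
  chart_cod_open : open chart_cod;
  chart_map_cod : forall p, chart_dom p -> chart_cod (chart_map p);
  chart_inv_dom : forall z, chart_cod z -> chart_dom (chart_inv z);
  chart_mapK : forall p, chart_dom p -> chart_inv (chart_map p) = p;
  chart_invK : forall z, chart_cod z -> chart_map (chart_inv z) = z;
  chart_map_cont : forall p, chart_dom p -> {for p, continuous chart_map};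
  chart_inv_cont : forall z, chart_cod z -> {for z, continuous chart_inv}
}.

(* The atlas need not be maximal; smoothness only depends on the maximal atlas
   that contains it. *)
Record manifold (n : nat) := Manifold {
  mspace :> topologicalType;
  atlas : set (chart n mspace);
  manifold_hausdorff : hausdorff_space mspace;
  manifold_second_countable : @second_countable mspace;
  atlas_cover : forall p : mspace, exists2 c, atlas c & chart_dom c p;
  atlas_compat : forall c c', atlas c -> atlas c' ->
    smooth_map_on (chart_cod c `&` chart_inv c @^-1` chart_dom c')
                  (c' \o chart_inv c)
}.
End Manifolds.

Arguments manifold R n : clear implicits.

Section SmoothFunctions.
Context {R : realType}.

Lemma chart_preim_open {n : nat} {T : topologicalType} (c : chart n T)
    (U : set T) :
  open U -> open (chart_cod (R := R) c `&` chart_inv c @^-1` U).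
Proof.
move=> oU; rewrite openE => z [cz Uz]; apply: filterI.
  by apply: open_nbhs_nbhs; split=> //; exact: chart_cod_open.
by apply: (chart_inv_cont cz); apply: open_nbhs_nbhs.
Qed.

Definition smooth_in {n : nat} {M : manifold R n} (U : set M) (f : M -> R) :=
  forall c, atlas c ->
    smooth_on (chart_cod c `&` chart_inv c @^-1` U) (f \o chart_inv c).

Record smooth_map {n p : nat} (M : manifold R n) (N : manifold R p) := SmoothMap {
  smooth_map_fun :> M -> N;
  smooth_map_continuous : continuous smooth_map_fun;
  smooth_map_charts : forall c c', atlas c -> atlas c' ->
    smooth_map_on
      (chart_cod c `&` (smooth_map_fun \o chart_inv c) @^-1` chart_dom c')
      (c' \o smooth_map_fun \o chart_inv c)
}.

Record diffeo {n p : nat} (M : manifold R n) (N : manifold R p) := Diffeo {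
  diffeo_map :> smooth_map M N;
  diffeo_inv : smooth_map N M;
  diffeo_mapK : cancel diffeo_map diffeo_inv;
  diffeo_invK : cancel diffeo_inv diffeo_map
}.

Section Theory.
Context {n : nat} {M : manifold R n}.
Implicit Types (U V : set M) (f g : M -> R).

Lemma smooth_in_local U f :
  (forall m, U m -> exists2 V, V m & smooth_in V f) -> smooth_in U f.
Proof.
move=> H c ac; apply: smooth_on_local => z [cz /H[V Vz sV]].
by exists (chart_cod c `&` chart_inv c @^-1` V) => //; exact: sV.
Qed.

Lemma smooth_in_sub U V f : U `<=` V -> smooth_in V f -> smooth_in U f.
Proof. by move=> UV sV; apply: smooth_in_local => m /UV Vm; exists V. Qed.

Lemma smooth_in_eq U f g : open U -> (forall m, U m -> f m = g m) ->
  smooth_in U f -> smooth_in U g.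
Proof.
move=> oU fg sf c ac; apply: smooth_on_eq (sf c ac).
  exact: chart_preim_open.
by move=> z; rewrite inE => -[_ Uz]; exact: fg.
Qed.

Lemma smooth_in_cst U (k : R) : smooth_in U (cst k).
Proof. by move=> c ac; exact: smooth_on_cst. Qed.

Lemma smooth_in_add U f g : open U ->
  smooth_in U f -> smooth_in U g -> smooth_in U (f + g).
Proof.
move=> oU sf sg c ac k.
exact: (Ck_add (chart_preim_open oU) (sf c ac k) (sg c ac k)).
Qed.

Lemma smooth_in_mul U f g : open U ->
  smooth_in U f -> smooth_in U g -> smooth_in U (f * g).
Proof.
move=> oU sf sg c ac k.
exact: (Ck_mul (chart_preim_open oU) (sf c ac k) (sg c ac k)).
Qed.

Lemma smooth_in_sum U (I : eqType) (r : seq I) (F : I -> M -> R) : open U ->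
  (forall i, smooth_in U (F i)) -> smooth_in U (fun m => \sum_(i <- r) F i m).
Proof.
move=> oU sF c ac k.
by apply: (Ck_sum (chart_preim_open oU)) => i _; exact: sF.
Qed.

Lemma smooth_in_chart c (h : 'rV[R]_n -> R) : atlas c ->
  smooth_on (chart_cod c) h -> smooth_in (chart_dom c : set M) (h \o c).
Proof.
move=> ac sh c' ac' k.
apply: (@Ck_comp _ _ _ k _ (chart_cod c) (c \o chart_inv c') h).
- exact/chart_preim_open/chart_dom_open.
- by move=> z [_ /chart_map_cod].
- by move=> j; exact: atlas_compat.
- exact: sh.
Qed.

Lemma smooth_in_comp {p : nat} {N : manifold R p} (phi : smooth_map M N)
    (U : set N) (f : N -> R) : open U ->
  smooth_in U f -> smooth_in (phi @^-1` U) (f \o phi).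
Proof.
move=> oU sf c ac; apply: smooth_on_local => z [cz Uz].
have [c' ac' c'z] := atlas_cover (phi (chart_inv c z)).
pose S := chart_cod c `&` (chart_inv c @^-1`
  (phi @^-1` (U `&` chart_dom c')))%classic.
have oS : open S.
  apply: chart_preim_open; apply: open_comp; first by move=> x _; exact: smooth_map_continuous.
  by apply: openI => //; exact: chart_dom_open.
exists S; first by [].
move=> k; apply: (@Ck_eq _ _ k S
  ((f \o chart_inv c') \o (c' \o phi \o chart_inv c))) => //.
  by move=> w; rewrite inE => -[_ [_ /= Hw]]; rewrite chart_mapK.
apply: (@Ck_comp _ _ _ k _ (chart_cod c' `&` chart_inv c' @^-1` U)) => //.
- move=> w [_ [Uw c'w]]; split; first exact: chart_map_cod.
  by rewrite /= chart_mapK.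
- move=> j.
  suff : smooth_on S (fun w => (c' \o phi \o chart_inv c) w ord0 j) by [].
  apply: smooth_on_sub; last exact: smooth_map_charts.
  by move=> w [? []].
- exact: sf.
Qed.

Lemma smooth_map_preim_open {p : nat} {N : manifold R p}
    (phi : smooth_map M N) (U : set N) : open U -> open (phi @^-1` U).
Proof.
by move=> oU; apply: open_comp => // m _; exact: smooth_map_continuous.
Qed.

End Theory.
End SmoothFunctions.

Section Cinfty.
Context {R : realType} {n : nat}.

Definition is_Cinf (M : manifold R n) : {pred M -> R} :=
  fun f => `[< smooth_in setT f >].
Arguments is_Cinf M _ : clear implicits.

Record Cinf (M : manifold R n) := MkCinf {
  Cinf_fun :> M -> R;
  Cinf_funP : Cinf_fun \in is_Cinf M
}.

Context {M : manifold R n}.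

HB.instance Definition _ := [isSub of Cinf M for @Cinf_fun M].
HB.instance Definition _ := [Choice of Cinf M by <:].

Lemma is_Cinf_subring_closed : subring_closed (is_Cinf M).
Proof.
split=> [|f g /asboolP sf /asboolP sg|f g /asboolP sf /asboolP sg].
- by apply/asboolP; exact: (smooth_in_cst _ 1).
- apply/asboolP; rewrite (_ : f - g = f + cst (-1) * g).
    apply: (smooth_in_add openT sf).
    exact: (smooth_in_mul openT (smooth_in_cst _ _) sg).
  by apply/funext => m; rewrite !fctE mulN1r.
- by apply/asboolP; exact: (smooth_in_mul openT sf sg).
Qed.

HB.instance Definition _ := GRing.isSubringClosed.Build _ (is_Cinf M)
  is_Cinf_subring_closed.
HB.instance Definition _ := 
  GRing.SubChoice_isSubComPzRing.Build _ _ (Cinf M) is_Cinf_subring_closed.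

Lemma is_Cinf_submod_closed : subsemimod_closed (is_Cinf M).
Proof.
split; first by split=> [|f g]; [exact: rpred0|exact: rpredD].
move=> k f /asboolP sf; apply/asboolP.
exact: (smooth_in_mul openT (smooth_in_cst _ k) sf).
Qed.

HB.instance Definition _ := GRing.isSubmodClosed.Build _ _ (is_Cinf M)
  is_Cinf_submod_closed.
HB.instance Definition _ := [SubZmodule_isSubLmodule of Cinf M by <:].

Lemma Cinf_smooth (f : Cinf M) : smooth_in setT f.
Proof. by have /asboolP := Cinf_funP f. Qed.

Lemma Cinf_eq (f g : Cinf M) : f =1 g -> f = g.
Proof. by move=> fg; apply/val_inj/funext. Qed.

End Cinfty.

Arguments is_Cinf {R n} M.

Lemma pullback_subproof {R : realType} {n p : nat} {M : manifold R n}
    {N : manifold R p} (phi : smooth_map M N) (f : Cinf N) :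
  (f \o phi) \in is_Cinf M.
Proof. by apply/asboolP; apply: smooth_in_comp openT (Cinf_smooth f). Qed.

Definition pullback {R : realType} {n p : nat} {M : manifold R n}
    {N : manifold R p} (phi : smooth_map M N) (f : Cinf N) : Cinf M :=
  MkCinf (pullback_subproof phi f).

Section Tangent.
Context {R : realType} {n : nat}.

Definition is_derivation_at (M : manifold R n) (p : M) : {pred Cinf M -> R} :=
  fun v => `[< (forall (k : R) (f g : Cinf M), v (k *: f + g) = k * v f + v g) /\
               (forall f g : Cinf M, v (f * g) = v f * g p + f p * v g) >].

Record tangent (M : manifold R n) (p : M) := Tangent {
  tangent_fun :> Cinf M -> R;
  tangent_funP : tangent_fun \in is_derivation_at p
}.

Context {M : manifold R n}.
Implicit Types p : M.

HB.instance Definition _ p := [isSub of tangent p for @tangent_fun M p].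
HB.instance Definition _ p := [Choice of tangent p by <:].

Lemma is_derivation_at_submod_closed p :
  subsemimod_closed (is_derivation_at p).
Proof.
split; [split|].
- have z0 h : (0 : Cinf M -> R) h = 0 by [].
  apply/asboolP; split=> [k f g|f g]; rewrite !z0 mulr0 ?mul0r addr0//.
- move=> v w /asboolP[vl vd] /asboolP[wl wd]; apply/asboolP.
  split=> [k f g|f g]; rewrite !fctE ?vl ?wl ?vd ?wd.
    by rewrite mulrDr addrACA.
  by rewrite mulrDl mulrDr addrACA.
- move=> a v /asboolP[vl vd]; apply/asboolP.
  split=> [k f g|f g]; rewrite !fctE ?vl ?vd.
    by rewrite scalerDr; congr (_ + _); exact: mulrCA.
  by rewrite scalerDr; congr (_ + _); [exact: mulrA|exact: mulrCA].
Qed.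

HB.instance Definition _ p := GRing.isSubmodClosed.Build _ _
  (is_derivation_at p) (is_derivation_at_submod_closed p).
HB.instance Definition _ p := [SubChoice_isSubLmodule of tangent p by <:].

Lemma tangent_eq p (v w : tangent p) : v =1 w -> v = w.
Proof. by move=> vw; apply/val_inj/funext. Qed.

(* [coord_vector c p a f] is the derivative at [p] of [f] in the direction with
   components [a] in the chart [c]; it is set to 0 outside of the chart. *)
Definition coord_vector_fun (c : chart n M) p (a : 'rV[R]_n) : Cinf M -> R :=
  fun f => if `[< chart_dom c p >] then 'D_a (f \o chart_inv c) (c p) else 0.

Lemma Cinf_chart (c : chart n M) (f : Cinf M) : atlas c ->
  smooth_on (chart_cod c) (f \o chart_inv c).
Proof. by move=> ac; apply: smooth_on_sub (Cinf_smooth f ac) => z. Qed.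

Lemma Cinf_chart_diff (c : chart n M) (f : Cinf M) p : atlas c ->
  chart_dom c p -> differentiable (f \o chart_inv c) (c p).
Proof.
by move=> ac cp; apply: (Cinf_chart f ac 1%N).1; exact: chart_map_cod.
Qed.

Lemma coord_vector_subproof (c : chart n M) (ac : atlas c) p a :
  coord_vector_fun c p a \in is_derivation_at p.
Proof.
apply/asboolP; rewrite /coord_vector_fun; case: asboolP => cp; last first.
  by split=> *; rewrite ?mulr0 ?mul0r addr0.
have D (f : Cinf M) : derivable (f \o chart_inv c) (c p) a.
  by apply: diff_derivable; exact: Cinf_chart_diff.
split=> [k f g|f g].
  have -> : (k *: f + g : Cinf M) \o chart_inv c =
     k *: (f \o chart_inv c) + (g \o chart_inv c) by [].
  by rewrite deriveD ?deriveZ//; exact: derivableZ.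
have -> : (f * g : Cinf M) \o chart_inv c =
   (f \o chart_inv c) * (g \o chart_inv c) by [].
rewrite deriveM// addrC; congr (_ + _); last by rewrite /= chart_mapK.
by rewrite /= chart_mapK// mulrC.
Qed.

Definition coord_vector (c : chart n M) (ac : atlas c) p (a : 'rV[R]_n) :
  tangent p := Tangent (coord_vector_subproof ac p a).

Lemma coord_vector_linear (c : chart n M) (ac : atlas c) p :
  linear (coord_vector ac p).
Proof.
move=> k a b; apply: tangent_eq => f; rewrite /= /coord_vector_fun !fctE /=.
rewrite /coord_vector_fun; case: asboolP => cp; last by rewrite scaler0 addr0.
have df := Cinf_chart_diff f ac cp.
by rewrite !deriveE// linearP.
Qed.

HB.instance Definition _ (c : chart n M) (ac : atlas c) p :=
  GRing.isLinear.Build R 'rV[R]_n (tangent p) _ (coord_vector ac p)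
    (coord_vector_linear ac p).
End Tangent.

Section Bundles.
Context {R : realType} {n : nat}.

Record local_frame (M : manifold R n) (r : nat) (E : M -> lmodType R) :=
  LocalFrame {
    frame_dom : set M;
    frame_map :> forall m, {linear 'rV[R]_r -> E m};
    frame_open : open frame_dom
  }.

(* The data of a vector bundle: its fibres, and a family of local frames (inverses
   of local trivialisations), from which the total space gets its topology and
   its smooth structure; [is_vector_bundle] states the axioms. *)
Record bundle (M : manifold R n) := Bundle {
  rank : nat;
  fibre :> M -> lmodType R;
  frames : set (local_frame rank fibre)
}.
Arguments frames {M} b _.

Record is_vector_bundle (M : manifold R n) (E : bundle M) : Prop := {
  frame_cover : forall m, exists2 e, frames E e & frame_dom e m;
  frame_bij : forall e, frames E e ->
    forall m, frame_dom e m -> bijective (e m);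
  frame_transition : forall e e', frames E e -> frames E e' ->
    exists G : M -> 'M[R]_(rank E),
      (forall i j, smooth_in (frame_dom e `&` frame_dom e') (fun m => G m i j)) /\
      (forall m, frame_dom e m -> frame_dom e' m ->
         forall a, e m a = e' m (a *m G m))
}.

Record Gamma (M : manifold R n) (E : bundle M) := MkGamma {
  Gamma_fun :> forall m, E m;
  Gamma_smooth : forall e, frames E e ->
    exists a : M -> 'rV[R]_(rank E),
      (forall j, smooth_in (frame_dom e) (fun m => a m ord0 j)) /\
      (forall m, frame_dom e m -> Gamma_fun m = e m (a m))
}.

Context {M : manifold R n} {E : bundle M}.
Implicit Types (s t u : Gamma E) (f : Cinf M).

Lemma Gamma_eq s t : (forall m, s m = t m) -> s = t.
Proof.
case: s t => [s sP] [t tP] /= st.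
have {}st : s = t by exact: functional_extensionality_dep.
by case: _ / st tP => tP; congr MkGamma; exact: Prop_irrelevance.
Qed.

Lemma Gamma_lin_subproof f s t e : frames E e ->
  exists a : M -> 'rV[R]_(rank E),
    (forall j, smooth_in (frame_dom e) (fun m => a m ord0 j)) /\
    (forall m, frame_dom e m -> f m *: s m + t m = e m (a m)).
Proof.
move=> Ee; have [a [sa ea]] := Gamma_smooth s Ee.
have [b [sb eb]] := Gamma_smooth t Ee.
exists (fun m => f m *: a m + b m); split=> [j|m em]; last first.
  by rewrite linearP ea// eb.
have oe := frame_open e.
have sf : smooth_in (frame_dom e) f.
  exact: smooth_in_sub (Cinf_smooth f).
apply: (smooth_in_eq oe _ (smooth_in_add oe (smooth_in_mul oe sf (sa j)) (sb j))).
by move=> m _; rewrite !mxE.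
Qed.

Lemma Gamma_zero_subproof e : frames E e ->
  exists a : M -> 'rV[R]_(rank E),
    (forall j, smooth_in (frame_dom e) (fun m => a m ord0 j)) /\
    (forall m, frame_dom e m -> 0 = e m (a m)).
Proof.
exists (fun=> 0); split=> [j|m _]; last by rewrite linear0.
apply: (smooth_in_eq (frame_open e) _ (smooth_in_cst _ 0)).
by move=> m _; rewrite mxE.
Qed.

Definition Gamma_zero : Gamma E := MkGamma Gamma_zero_subproof.
Definition Gamma_lin f s t : Gamma E := MkGamma (Gamma_lin_subproof f s t).

HB.instance Definition _ := gen_eqMixin (Gamma E).
HB.instance Definition _ := gen_choiceMixin (Gamma E).

Let add s t := Gamma_lin 1 s t.
Let opp s := Gamma_lin (- 1) s Gamma_zero.
Let scale (k : R) s := Gamma_lin (k *: (1 : Cinf M)) s Gamma_zero.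

Let addE s t m : add s t m = s m + t m.
Proof. by rewrite /= scale1r. Qed.
Let oppE s m : opp s m = - s m.
Proof. by rewrite /= scaleN1r addr0. Qed.
Let scaleE k s m : scale k s m = k *: s m.
Proof.
by rewrite /= addr0; congr (_ *: _); exact: (mulr1 k).
Qed.

Let addA : associative add.
Proof. by move=> s t u; apply: Gamma_eq => m; rewrite !addE addrA. Qed.
Let addC : commutative add.
Proof. by move=> s t; apply: Gamma_eq => m; rewrite !addE addrC. Qed.
Let add0 : left_id Gamma_zero add.
Proof. by move=> s; apply: Gamma_eq => m; rewrite !addE add0r. Qed.
Let addN : left_inverse Gamma_zero opp add.
Proof. by move=> s; apply: Gamma_eq => m; rewrite !addE oppE addNr. Qed.

HB.instance Definition _ := GRing.isZmodule.Build (Gamma E) addA addC add0 addN.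

Let scaleA a b s : scale a (scale b s) = scale (a * b) s.
Proof. by apply: Gamma_eq => m; rewrite !scaleE scalerA. Qed.
Let scale1 : left_id 1 scale.
Proof. by move=> s; apply: Gamma_eq => m; rewrite !scaleE scale1r. Qed.
Let scaleDr : right_distributive scale +%R.
Proof.
by move=> k s t; apply: Gamma_eq => m; rewrite scaleE !addE !scaleE scalerDr.
Qed.
Let scaleDl s : {morph scale^~ s : a b / a + b}.
Proof.
by move=> a b; apply: Gamma_eq => m; rewrite scaleE addE !scaleE scalerDl.
Qed.

HB.instance Definition _ :=
  GRing.Zmodule_isLmodule.Build R (Gamma E) scaleA scale1 scaleDr scaleDl.

Lemma GammaDE s t m : (s + t) m = s m + t m. Proof. exact: addE. Qed.
Lemma GammaNE s m : (- s) m = - s m. Proof. exact: oppE. Qed.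
Lemma GammaZE k s m : (k *: s) m = k *: s m. Proof. exact: scaleE. Qed.

Definition Cscale f s : Gamma E := Gamma_lin f s 0.

Lemma CscaleE f s m : Cscale f s m = f m *: s m.
Proof. by rewrite /= addr0. Qed.
End Bundles.

Arguments frames {R n M} b _.

Section BundleConstructions.
Context {R : realType} {n : nat}.

Definition coord_frame {M : manifold R n} (c : chart n M) (ac : atlas c) :
    local_frame n (fun p : M => tangent p : lmodType R) :=
  LocalFrame (fun p => coord_vector ac p : {linear 'rV[R]_n -> tangent p})
    (chart_dom_open c).

Definition tangent_bundle (M : manifold R n) : bundle M :=
  Bundle [set e | exists c (ac : atlas c), e = coord_frame ac].

Definition pullback_frame {p : nat} {M : manifold R n} {N : manifold R p}
    (phi : smooth_map M N) (r : nat) (E : N -> lmodType R)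
    (e : local_frame r E) : local_frame r (fun m => E (phi m)) :=
  LocalFrame (fun m => e (phi m))
    (smooth_map_preim_open phi (frame_open e)).

Definition pullback_bundle {p : nat} {M : manifold R n} {N : manifold R p}
    (phi : smooth_map M N) (E : bundle N) : bundle M :=
  Bundle (@pullback_frame _ _ _ phi _ _ @` frames E).

Definition is_bundle_map {M : manifold R n} (A B : bundle M)
    (a : forall m, {linear A m -> B m}) : Prop :=
  forall e e', frames A e -> frames B e' ->
    exists G : M -> 'M[R]_(rank A, rank B),
      (forall i j, smooth_in (frame_dom e `&` frame_dom e') (fun m => G m i j)) /\
      (forall m, frame_dom e m -> frame_dom e' m ->
         forall u, a m (e m u) = e' m (u *m G m)).

Section Action.
Context {M N : manifold R n} {phi : smooth_map M N}.

Lemma act_subproof (x : Gamma (pullback_bundle phi (tangent_bundle N)))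
  (f : Cinf N) : (fun m => (x m : tangent (phi m)) f) \in is_Cinf M.
Proof.
apply/asboolP; apply: smooth_in_local => m _.
have [c ac cm] := atlas_cover (phi m).
have Fe : frames (pullback_bundle phi (tangent_bundle N))
    (pullback_frame phi (coord_frame ac)).
  by exists (coord_frame ac) => //; exists c, ac.
have [a [sa xa]] := Gamma_smooth x Fe.
pose e := pullback_frame phi (coord_frame ac).
have oe : open (frame_dom e) := frame_open e.
exists (frame_dom e) => //.
have sD (v : 'rV[R]_n) :
    smooth_in (frame_dom e) ('D_v (f \o chart_inv c) \o c \o phi).
  apply: smooth_in_comp; first exact: chart_dom_open.
  apply: (smooth_in_chart ac) => k; exact: (Cinf_chart f ac k.+1).2.
have := smooth_in_sum (index_enum 'I_n) oe
  (fun j => smooth_in_mul oe (sa j) (sD (delta_mx ord0 j))).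
apply: (smooth_in_eq oe) => w ew.
rewrite xa//= /coord_vector_fun; case: asboolP => // _.
have df := Cinf_chart_diff f ac ew.
rewrite deriveE// [X in 'd _ _ X](row_sum_delta (a w)) linear_sum.
by apply: eq_bigr => j _; rewrite [RHS]linearZ -(deriveE _ df).
Qed.

Definition act (x : Gamma (pullback_bundle phi (tangent_bundle N)))
  (f : Cinf N) : Cinf M := MkCinf (act_subproof x f).

(* A section is determined by the operator it induces, hence it may be specified
   by a formula for that operator. *)
Lemma act_inj : injective act.
Proof.
move=> x y xy; apply: Gamma_eq => m; apply: tangent_eq => f.
exact: (congr1 (fun a : Cinf N -> Cinf M => a f m) xy).
Qed.
End Action.
End BundleConstructions.

Section HomLie.
Context {R : realType}.

Record is_hom_lie_algebra (g : lmodType R) (br : g -> g -> g) (phi : g -> g) :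
    Prop := {
  hom_lie_phi_linear : linear phi;
  hom_lie_linear_l : forall y, linear (br^~ y);
  hom_lie_linear_r : forall x, linear (br x);
  hom_lie_skew : forall x y, br x y = - br y x;
  hom_lie_mult : forall x y, phi (br x y) = br (phi x) (phi y);
  hom_lie_jacobi : forall x y z,
    br (phi x) (br y z) + br (phi y) (br z x) + br (phi z) (br x y) = 0
}.

Record is_representation (g : lmodType R) (br : g -> g -> g) (phi : g -> g)
    (V : lmodType R) (beta : V -> V) (rho : g -> V -> V) : Prop := {
  rep_beta_linear : linear beta;
  rep_linear : forall x, linear (rho x);
  rep_linear_l : forall v, linear (rho^~ v);
  rep_phi : forall x, rho (phi x) \o beta =1 beta \o rho x;
  rep_br : forall x y, rho (br x y) \o beta =1
    (rho (phi x) \o rho y) \- (rho (phi y) \o rho x)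
}.

Context {n : nat} {M : manifold R n}.

Record is_hom_bundle (A : bundle M) (phi : smooth_map M M)
    (phiA : Gamma A -> Gamma A) : Prop := {
  hom_bundle_vector : is_vector_bundle A;
  hom_bundle_linear : linear phiA;
  hom_bundle_semilinear : forall (f : Cinf M) (x : Gamma A),
    phiA (Cscale f x) = Cscale (pullback phi f) (phiA x)
}.

Record is_hom_lie_algebroid (A : bundle M) (phi : smooth_map M M)
    (phiA : Gamma A -> Gamma A) (br : Gamma A -> Gamma A -> Gamma A)
    (a : forall m, {linear A m -> pullback_bundle phi (tangent_bundle M) m}) :
    Prop := {
  algebroid_hom_bundle : is_hom_bundle phi phiA;
  algebroid_hom_lie : is_hom_lie_algebra br phiA;
  algebroid_anchor : is_bundle_map a;
  (* [rho x f] is [a_A(x)(f)]; it is determined by the first condition *)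
  algebroid_rho : exists rho : Gamma A -> Cinf M -> Cinf M,
    [/\ forall x f m, rho x f m = (a m (x m) : tangent (phi m)) f,
        forall x y (f : Cinf M),
          br x (Cscale f y) =
          Cscale (pullback phi f) (br x y) + Cscale (rho (phiA x) f) (phiA y) &
        is_representation br phiA (pullback phi) rho]
}.
End HomLie.

(* Main.v *)
Require Import Defs.
From HB Require Import structures.
From mathcomp Require Import all_boot all_order all_algebra ring.
From mathcomp Require Import all_classical reals ereal constructive_ereal.
From mathcomp Require Import topology normedtype landau derive sequences.
From mathcomp Require Import realfun exp measure lebesgue_measure.
From mathcomp Require Import lebesgue_integral ftc.

Set Implicit Arguments.
Unset Strict Implicit.
Unset Printing Implicit Defensive.

Import Order.TTheory GRing.Theory Num.Theory.
Import numFieldNormedType.Exports.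

Local Open Scope classical_set_scope.
Local Open Scope ring_scope.

(* Write P for the pullback of functions along phi.  Ad x and [x, y] are
   (P, P)-derivations of C^oo(M), and once such derivations are known to be
   sections of phi^!TM, every axiom is an identity between operators, because a
   section is determined by its action.

   A derivation D gives at each m the tangent vector f |-> D f m at phi m.
   Bump functions make tangent vectors local and extend the coordinates x_j of a
   chart, near a point, to global functions X_j.  By Hadamard's lemma a
   tangent vector v is then the coordinate vector with components v (X_j), so
   locally the section has components D (X_j), which are smooth.  The same
   description gives the bijectivity of the frames and the smoothness of the
   transition matrices of the bundle. *)

(** * A flat function on the real line *)

Section Flat.
Context {R : realType}.

(* The functions t^-i exp(-1/t) are stable, up to linear combinations, under
   derivation; hence their smoothness by a simultaneous induction on i. *)
Definition flat (i : nat) (t : R) : R :=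
  if 0 < t then t^-1 ^+ i * expR (- t^-1) else 0.

Lemma flat_gt0 i t : 0 < t -> 0 < flat i t.
Proof.
by move=> t0; rewrite /flat t0 mulr_gt0 ?expR_gt0// exprn_gt0 ?invr_gt0.
Qed.

Lemma flat_eq0 i t : t <= 0 -> flat i t = 0.
Proof. by rewrite /flat leNgt => /negbTE ->. Qed.

(** For t > 0 put u = 1/t: the term u^(i+2)/(i+2)! of the exponential series is at most exp u. The
    exponent 2 is what makes the difference quotients of [flat i] at 0 tend to 0. *)
Lemma flat_le i t : `|flat i t| <= (i.+2)`!%:R * t ^+ 2.
Proof.
have [t0|t0] := ltP 0 t; last first.
  by rewrite flat_eq0// normr0 mulr_ge0// sqr_ge0.
rewrite gtr0_norm ?flat_gt0// /flat t0 expRN ler_pdivrMr ?expR_gt0//.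
have u0 : 0 < t^-1 by rewrite invr_gt0.
have : (t^-1) ^+ i.+2 / (i.+2)`!%:R <= expR t^-1.
  by apply: le_trans (expR_ge1Dxn i.+1 (ltW u0)); rewrite lerDr.
rewrite ler_pdivrMr ?ltr0n ?fact_gt0// => H.
have -> : t^-1 ^+ i = t^-1 ^+ i.+2 * t ^+ 2.
  by rewrite -addn2 exprD -mulrA -exprMn mulVf ?gt_eqF// expr1n mulr1.
by rewrite [leRHS]mulrAC ler_wpM2r ?sqr_ge0// [leRHS]mulrC.
Qed.

Lemma is_derive_flat i (t : R) :
  is_derive t 1 (flat i) (- i%:R * flat i.+1 t + flat i.+2 t).
Proof.
have [t0|t0|->] := ltgtP t 0.
- rewrite !flat_eq0 ?(ltW t0)// mulr0 addr0.
  apply: (near_eq_is_derive (f := cst 0)).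
    by near=> s; rewrite flat_eq0// ltW//; near: s; exact: lt_nbhsl.
- have dinv : is_derive t 1 (fun s : R => s^-1) (- t^-1 ^+ 2).
    have t1 : t != 0 by rewrite gt_eqF.
    split; first exact: (@derivableV _ _ id).
    by rewrite (@deriveV _ _ id)// derive_id exprVn [LHS]mulr1.
  have d1 := is_deriveX i dinv.
  have d2 := @is_derive1_comp _ expR (fun s => - s^-1) t _ _
    (is_derive_expR _) (is_deriveN dinv).
  apply: (near_eq_is_derive
    (f := (fun s : R => s^-1) ^+ i * (expR \o (fun s => - s^-1)))).
    near=> s; rewrite /flat ifT ?fctE//; near: s; exact: lt_nbhsr.
  apply: (is_derive_eq (is_deriveM d1 d2)).
  rewrite /flat t0 /= !scalerA /GRing.scale/=.
  have -> : ((fun s : R => s^-1) ^+ i) t = t^-1 ^+ i by rewrite exprfctE.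
  by case: {d1} i => [|i]; rewrite /= !exprS -?[i.+1%:R]natr1; ring.
(* At 0 the quadratic bound [flat_le] bounds the difference quotient by (i+2)! |h|. *)
- rewrite !flat_eq0// mulr0 addr0.
  have dd :
      (fun h : R => h^-1 *: (flat i (h + 0) - flat i 0)) @ 0^' --> (0 : R).
    apply/cvgr0Pnorm_le => e e0.
    have c0 : 0 < (i.+2)`!%:R :> R by rewrite ltr0n fact_gt0.
    near=> h; rewrite (flat_eq0 i (lexx 0)) subr0 addr0 normrZ.
    have h0 : h != 0 by near: h; exact: nbhs_dnbhs_neq.
    rewrite normfV ler_pdivrMl ?normr_gt0// (le_trans (flat_le i h))//.
    rewrite -(real_normK (num_real h)) expr2 mulrCA ler_pM2l ?normr_gt0//.
    rewrite mulrC -ler_pdivlMr// ltW//; near: h; apply: dnbhs0_lt.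
    exact: divr_gt0.
  have dE : (fun h : R => h^-1 *: ((flat i \o shift 0) (h *: 1) - flat i 0)) =
            (fun h => h^-1 *: (flat i (h + 0) - flat i 0)).
    by apply/funext => h; rewrite /= /GRing.scale /= mulr1.
  split; first by rewrite /derivable dE; apply/cvg_ex; exists 0.
  by rewrite /derive dE; exact: cvg_lim.
Unshelve. all: by end_near. Qed.
End Flat.

(** * Bump functions and extension of smooth functions on R^n *)

Section SmoothOn.
Context {R : realType} {n : nat}.
Implicit Types (S : set 'rV[R]_n) (f g : 'rV[R]_n -> R).

Lemma smooth_on_derive S f v : smooth_on S f -> smooth_on S ('D_v f).
Proof. by move=> sf k; exact: (sf k.+1).2. Qed.

Lemma smooth_on_diff S f z : smooth_on S f -> S z -> differentiable f z.
Proof. by move=> /(_ 1%N)[df _]; exact: df. Qed.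

Lemma smooth_on_add S f g : open S ->
  smooth_on S f -> smooth_on S g -> smooth_on S (f + g).
Proof. by move=> oS sf sg k; exact: Ck_add. Qed.

Lemma smooth_on_mul S f g : open S ->
  smooth_on S f -> smooth_on S g -> smooth_on S (f * g).
Proof. by move=> oS sf sg k; exact: Ck_mul. Qed.

Lemma derive_rV_coord (z v : 'rV[R]_n) j :
  'D_v (fun w : 'rV[R]_n => w ord0 j) z = v ord0 j.
Proof. by rewrite (@derive_coord _ _ _ id)// derive_id. Qed.

Lemma smooth_on_coord S j : smooth_on S (fun z => z ord0 j).
Proof.
case=> [z _|k]; first exact/differentiable_continuous/differentiable_coord.
split=> [z _|v]; first exact: differentiable_coord.
under eq_fun do rewrite derive_rV_coord; exact: Ck_cst.
Qed.

Lemma derive_flat i g z v : differentiable g z ->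
  'D_v (flat i \o g) z =
  (- i%:R * flat i.+1 (g z) + flat i.+2 (g z)) * 'D_v g z.
Proof.
move=> dg; have [df Df] := is_derive_flat i (g z).
have dfl : differentiable (flat i) (g z) by exact/derivable1_diffP.
rewrite !deriveE//; last exact: differentiable_comp.
rewrite diff_comp//= (deriv1E df) derive1E Df; exact: mulrC.
Qed.

Lemma smooth_on_flat S i g : open S -> smooth_on S g ->
  smooth_on S (flat i \o g).
Proof.
move=> oS sg k; elim: k i => [|k IH] i.
  move=> z Sz; apply: (@continuous_comp _ _ _ g (flat i)); first exact: (sg 0%N).
  apply/differentiable_continuous/derivable1_diffP.
  by have [] := is_derive_flat i (g z).
split=> [z Sz|v].
  apply: differentiable_comp; first exact: smooth_on_diff sg Sz.
  by apply/derivable1_diffP; have [] := is_derive_flat i (g z).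
apply: (@Ck_eq _ _ _ _
  ((cst (- i%:R) * (flat i.+1 \o g) + (flat i.+2 \o g)) * 'D_v g)).
- exact: oS.
- move=> z; rewrite inE => Sz.
  by rewrite (derive_flat _ _ (smooth_on_diff sg Sz)).
apply: Ck_mul => //; last exact: (sg k.+1).2.
by apply: Ck_add => //; apply: Ck_mul => //; exact: Ck_cst.
Qed.

Lemma closed_ball_rV_compact (p : 'rV[R]_n) r :
  0 < r -> compact (closed_ball p r).
Proof.
move=> r0; apply: bounded_closed_compact; last exact: closed_ball_closed.
exists (`|p| + r); split; first exact: num_real.
move=> M ltM z; rewrite closed_ballE// /closed_ball_/= => pz.
apply: le_trans (ltW ltM); rewrite -[z](subrK p) addrC.
by rewrite (le_trans (ler_normD _ _))// lerD2l distrC.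
Qed.

Lemma bump_rV (U : set 'rV[R]_n) p : open U -> U p ->
  exists (chi : 'rV[R]_n -> R) (K : set 'rV[R]_n),
    [/\ smooth_on setT chi, \near p, chi p = 1, compact K, K `<=` U &
        forall z, ~ K z -> chi z = 0].
Proof.
move=> oU Up.
have [r r0 pU] : exists2 r : R, 0 < r & ball p r `<=` U.
  by have /nbhs_ballP[r r0 pU] := open_nbhs_nbhs (conj oU Up); exists r.
pose s := r / 2; have s0 : 0 < s by rewrite divr_gt0.
pose q (z : 'rV[R]_n) := \sum_j (z ord0 j - p ord0 j) ^+ 2.
(* With d = flat 0 (s^2), chi is 1 where g > d/2, in particular near p, where
   g = d, and 0 where g = 0, that is, where q >= s^2. *)
pose d : R := flat 0 (s ^+ 2); have d0 : 0 < d by rewrite flat_gt0// exprn_gt0.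
pose g := flat 0 \o (cst (s ^+ 2) + cst (-1) * q).
pose chi z := 1 - (flat 0 (d / 2))^-1 * flat 0 (d / 2 - g z).
have sq : smooth_on setT q.
  move=> k; apply: Ck_sum; first exact: openT.
  move=> j _.
  have -> : (fun z : 'rV[R]_n => (z ord0 j - p ord0 j) ^+ 2) =
      ((fun z => z ord0 j) + cst (- p ord0 j)) *
      ((fun z => z ord0 j) + cst (- p ord0 j)).
    by apply/funext => z; rewrite !fctE expr2.
  suff H : Ck k setT ((fun z : 'rV[R]_n => z ord0 j) + cst (- p ord0 j)).
    by apply: Ck_mul => //; exact: openT.
  apply: Ck_add; [exact: openT|exact: smooth_on_coord|exact: Ck_cst].
have sg : smooth_on setT g.
  apply: smooth_on_flat; first exact: openT.
  apply: smooth_on_add; [exact: openT|exact: smooth_on_cst|].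
  by apply: smooth_on_mul => //; [exact: openT|exact: smooth_on_cst].
exists chi, (closed_ball p s); split.
- have -> : chi = cst 1 + cst (- (flat 0 (d / 2))^-1) *
       (flat 0 \o (cst (d / 2) + cst (-1) * g)).
    by apply/funext => z; rewrite !fctE /= /chi mulNr mulN1r.
  apply: smooth_on_add; [exact: openT|exact: smooth_on_cst|].
  apply: smooth_on_mul; [exact: openT|exact: smooth_on_cst|].
  apply: smooth_on_flat; first exact: openT.
  apply: smooth_on_add; [exact: openT|exact: smooth_on_cst|].
  by apply: smooth_on_mul => //; [exact: openT|exact: smooth_on_cst].
- have cg : {for p, continuous g} by exact: (sg 0%N).
  have gp : g p = d.
    rewrite /g /= !fctE /q big1 ?mulr0 ?addr0// => j _.
    by rewrite subrr expr0n.
  have : d / 2 < g p by rewrite gp ltr_pdivrMr// ltr_pMr// ltr1n.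
  move=> /(cvgr_gt (g p) cg); apply: filterS => z /= dz.
  rewrite /chi (flat_eq0 0 (_ : d / 2 - g z <= 0)) ?mulr0 ?subr0//.
  by rewrite subr_le0 ltW.
- exact: closed_ball_rV_compact.
- apply: subset_trans pU; apply: closed_ball_subset => //.
  by rewrite ltr_pdivrMr// ltr_pMr// ltr1n.
- move=> z; rewrite closed_ballE// /closed_ball_/= => /negP; rewrite -ltNge => sz.
  (* The norm is the maximum norm, so some coordinate of p - z exceeds s in absolute value; its
     square is one of the nonnegative terms of q z. *)
  have [[i j]] : exists i, mx_norm (p - z) = `|(p - z) i.1 i.2|.
    by apply: mx_norm_neq0; rewrite gt_eqF// (lt_trans s0).
  rewrite /= ord1 => zj.
  have sqz : s ^+ 2 <= q z.
    have : s ^+ 2 <= (z ord0 j - p ord0 j) ^+ 2.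
      rewrite -[leRHS]real_normK ?num_real// distrC.
      rewrite ler_sqr ?nnegrE ?(ltW s0)// ltW//.
      by move: sz; rewrite [`|_|]zj !mxE.
    move=> /le_trans; apply; rewrite /q (bigD1 j)//= lerDl.
    by apply: sumr_ge0 => ? _; exact: sqr_ge0.
  rewrite /chi /g /= (flat_eq0 0 (_ : (_ + _) z <= 0)).
    by rewrite subr0 mulVf ?subrr// gt_eqF// flat_gt0// divr_gt0.
  by rewrite !fctE mulN1r subr_le0.
Qed.

(** The open sets S and the complement of K cover the space; g agrees with f on the first and
    vanishes on the second. *)
Lemma extend_by_zero (S K : set 'rV[R]_n) f g :
  open S -> K `<=` S -> closed K ->
  smooth_on S f -> {in S, f =1 g} -> (forall z, ~ K z -> g z = 0) ->
  smooth_on setT g.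
Proof.
move=> oS KS cK sf fg g0; apply: smooth_on_local => z _.
have [Kz|nKz] := pselect (K z).
  by exists S; [exact: KS|exact: smooth_on_eq sf].
exists (~` K) => //; apply: (@smooth_on_eq _ _ _ (cst 0)).
  exact: closed_openC.
  by move=> w; rewrite inE => /g0 ->.
exact: smooth_on_cst.
Qed.

(** Replaces a function on a chart codomain, which need not be star-shaped, by one smooth on all of
    R^n, to which the integral formula of Hadamard's lemma applies. *)
Lemma extension_rV S f p : open S -> S p -> smooth_on S f ->
  exists2 g, smooth_on setT g & \near p, g p = f p.
Proof.
move=> oS Sp sf; have [chi [K [schi chi1 cK KS chi0]]] := bump_rV oS Sp.
exists (fun z => if z \in S then chi z * f z else 0).
  apply: (@extend_by_zero S K (chi * f)) => //.
  - by apply: compact_closed cK; exact: norm_hausdorff.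
  - apply: smooth_on_mul => //; exact: smooth_on_sub schi.
  - by move=> z Sz; rewrite Sz.
  - by move=> z /chi0 ->; rewrite mul0r if_same.
near=> z; rewrite ifT; last by rewrite inE; near: z; exact: open_nbhs_nbhs.
by rewrite (near chi1 z)// mul1r.
Unshelve. all: by end_near. Qed.
End SmoothOn.

(** * Bump functions on a manifold and locality of tangent vectors *)

Section TangentLocal.
Context {R : realType} {n : nat} {M : manifold R n}.
Implicit Types (f g : Cinf M) (q : M).

(** The cut-off is made in a chart. Its support K is compact, hence so is the image of K in M, which
    is closed because M is Hausdorff; extension by zero is therefore smooth. *)
Lemma extension_Cinf (U : set M) q (f : M -> R) : open U -> U q ->
  smooth_in U f ->
  exists2 g : Cinf M, \near q, g q = f q & forall m, ~ U m -> g m = 0.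
Proof.
move=> oU Uq sf; have [c ac cq] := atlas_cover q.
pose V := chart_dom c `&` U.
have oV : open V by apply: openI => //; exact: chart_dom_open.
have cqW : (chart_cod c `&` chart_inv c @^-1` U) (c q).
  by split; [exact: chart_map_cod|rewrite /= chart_mapK].
have [chi [K [schi chi1 cK KW chi0]]] := bump_rV (chart_preim_open oU) cqW.
(* The values of the chart map outside its domain are arbitrary, hence the explicit test. *)
pose g m := if m \in V then chi (c m) * f m else 0.
have ccK : closed (chart_inv c @` K).
  apply: compact_closed; first exact: manifold_hausdorff.
  apply: continuous_compact => //; apply: continuous_in_subspaceT => z.
  by rewrite inE => /KW[cz _]; exact: chart_inv_cont.
have sg : g \in is_Cinf M.
  apply/asboolP; apply: smooth_in_local => m _.
  have [[z Kz zm]|nKm] := pselect ((chart_inv c @` K) m).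
    have [cz Uz] := KW _ Kz.
    exists V; first by rewrite -zm; split => //; exact: chart_inv_dom.
    apply: (@smooth_in_eq _ _ _ _ ((chi \o c) * f)) => //.
      by move=> w Vw; rewrite /g ifT// inE.
    apply: smooth_in_mul => //; last by apply: smooth_in_sub sf => w [].
    apply: (@smooth_in_sub _ _ _ _ (chart_dom c)) => [w []//|].
    by apply: smooth_in_chart => //; exact: smooth_on_sub schi.
  exists (~` (chart_inv c @` K)) => //.
  apply: (@smooth_in_eq _ _ _ _ (cst 0)); first exact: closed_openC.
    move=> w nKw; rewrite /g; case: ifPn => //; rewrite inE => -[cw _].
    rewrite chi0 ?mul0r// => Kcw; apply: nKw; exists (c w) => //.
    exact: chart_mapK.
  exact: smooth_in_cst.
exists (MkCinf sg) => [|m nUm] /=; last first.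
  by rewrite /g ifF//; apply/negP; rewrite inE => -[].
have cc : {for q, continuous c} by exact: chart_map_cont.
have chic : \near q, chi (c q) = 1 by exact: cc chi1.
near=> m; rewrite /g ifT; last first.
  by rewrite inE; near: m; apply: open_nbhs_nbhs.
by rewrite (near chic m)// mul1r.
Unshelve. all: by end_near. Qed.

Section Derivation.
Context {q : M}.
Implicit Type v : tangent q.

Lemma tangentP v k f g : v (k *: f + g) = k * v f + v g.
Proof. by have /asboolP[] := tangent_funP v. Qed.

Lemma tangentM v f g : v (f * g) = v f * g q + f q * v g.
Proof. by have /asboolP[] := tangent_funP v. Qed.

Lemma tangentD v f g : v (f + g) = v f + v g.
Proof. by rewrite -[in LHS](scale1r f) tangentP mul1r. Qed.

Lemma tangent0 v : v 0 = 0.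
Proof. by apply: (addrI (v 0)); rewrite -tangentD !addr0. Qed.

Lemma tangentZ v k f : v (k *: f) = k * v f.
Proof. by rewrite -[in LHS](addr0 (k *: f)) tangentP tangent0 addr0. Qed.

Lemma tangent_sum v (I : Type) (r : seq I) (F : I -> Cinf M) :
  v (\sum_(i <- r) F i) = \sum_(i <- r) v (F i).
Proof.
elim: r => [|i r IH]; first by rewrite !big_nil tangent0.
by rewrite !big_cons tangentD IH.
Qed.

Lemma tangent1 v : v 1 = 0.
Proof.
apply: (addrI (v 1)); rewrite addr0 -[in RHS](mulr1 1) tangentM /=.
by rewrite mulr1 mul1r.
Qed.

(** If b is 1 near q and 0 outside a neighbourhood where f = g, then (f - g) b = 0, and the Leibniz
    rule at q turns this into v (f - g) = 0. *)
Lemma tangent_local v f g : (\near q, f q = g q) -> v f = v g.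
Proof.
move=> fg; have : nbhs q [set m | f m = g m] := fg.
rewrite nbhsE => -[U [oU Uq] fgU].
have [b b1 b0] := extension_Cinf oU Uq (smooth_in_cst U 1).
have : v ((f - g) * b) = 0.
  rewrite -(tangent0 v); congr (v _); apply: Cinf_eq => m /=.
  have [/fgU fgm|/b0 bm] := pselect (U m).
    by rewrite !fctE/= fgm subrr mul0r.
  by rewrite !fctE/= bm mulr0.
rewrite tangentM (nbhs_singleton b1) mulr1 /= !fctE (nbhs_singleton fg).
rewrite subrr mul0r addr0 -scaleN1r addrC tangentP mulN1r addrC.
by move/eqP; rewrite subr_eq0 => /eqP.
Qed.
End Derivation.

(** Here [h] is a bare function, so that it can be a chart coordinate, which is smooth only on the
    domain of the chart. *)
Lemma coord_vector_local (c : chart n M) (ac : atlas c) q a f (h : M -> R) :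
  chart_dom c q -> (\near q, f q = h q) ->
  coord_vector ac q a f = 'D_a (h \o chart_inv c) (c q).
Proof.
move=> cq fh; rewrite /= /coord_vector_fun; case: asboolP => // _.
apply: near_eq_derive.
have cont : chart_inv c @ c q --> q.
  have := chart_inv_cont (chart_map_cod cq).
  by rewrite /prop_for /continuous_at chart_mapK.
exact: cont fh.
Qed.
End TangentLocal.

(** * Integration of continuous functions over the unit interval *)

Section ContinuousReal.
Context {R : realType}.
Implicit Types f g : R -> R.

Lemma continuous_mul f g : continuous f -> continuous g ->
  continuous (fun t => f t * g t).
Proof. by move=> cf cg t; exact: cvgM (cf t) (cg t). Qed.

Lemma continuous_add f g : continuous f -> continuous g ->
  continuous (fun t => f t + g t).
Proof. by move=> cf cg t; exact: cvgD (cf t) (cg t). Qed.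

Lemma continuous_scale k f : continuous f -> continuous (fun t => k * f t).
Proof. by apply: continuous_mul => t; exact: cst_continuous. Qed.

Lemma continuous_sum (I : Type) (r : seq I) (F : I -> R -> R) :
  (forall i, continuous (F i)) -> continuous (fun t => \sum_(i <- r) F i t).
Proof.
move=> cF; elim: r => [|i r IH].
  by under eq_fun do rewrite big_nil; move=> t; exact: cst_continuous.
by under eq_fun do rewrite big_cons; exact: continuous_add.
Qed.
End ContinuousReal.

Section UnitIntegral.
Context {R : realType}.
Implicit Types f g : R -> R.

Definition int01 f : R := \int[lebesgue_measure]_(t in `[0, 1]) f t.

Lemma int01_integrable f : continuous f ->
  (@lebesgue_measure R).-integrable `[0, 1] (EFin \o f).
Proof.
move=> cf; apply: continuous_compact_integrable; first exact: segment_compact.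
exact: continuous_subspaceT.
Qed.

Lemma int01D f g : continuous f -> continuous g ->
  int01 (fun t => f t + g t) = int01 f + int01 g.
Proof. by move=> cf cg; apply: RintegralD => //; exact: int01_integrable. Qed.

Lemma int01Z k f : continuous f -> int01 (fun t => k * f t) = k * int01 f.
Proof. by move=> cf; apply: RintegralZl => //; exact: int01_integrable. Qed.

Lemma int01_FTC f g : continuous f -> (forall t : R, is_derive t 1 g (f t)) ->
  int01 f = g 1 - g 0.
Proof.
move=> cf dg; rewrite /int01 /Rintegral (@continuous_FTC2 _ f g)//.
- exact: continuous_subspaceT.
- have cg : continuous g.
    by move=> t; apply/differentiable_continuous/derivable1_diffP; have [] := dg t.
  split.
  + by move=> t _; have [] := dg t.
  + by apply: cvg_at_right_filter; exact: cg.
  + by apply: cvg_at_left_filter; exact: cg.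
- by move=> t _; rewrite derive1E; have [_ ->] := dg t.
Qed.

Lemma int01_cst (k : R) : int01 (cst k) = k.
Proof.
have cc : continuous (cst k : R -> R) by move=> t; exact: cst_continuous.
have dk (t : R) : is_derive t 1 (fun s => s * k) (cst k t).
  by apply: is_derive_eq; rewrite scaler0 add0r [LHS]mulr1.
by rewrite (int01_FTC cc dk) mul1r mul0r subr0.
Qed.

Lemma int01_le (k : R) f : continuous f ->
  (forall t, 0 <= t <= 1 -> `|f t| <= k) -> `|int01 f| <= k.
Proof.
move=> cf fk.
apply: (le_trans (le_normr_Rintegral _ (int01_integrable cf))) => //.
rewrite -[leRHS]int01_cst; apply: le_Rintegral => //.
- apply: int01_integrable => t.
  by apply: continuous_comp; [exact: cf|exact: norm_continuous].
- by apply: int01_integrable => t; exact: cst_continuous.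
Qed.

Lemma int01_sum (I : Type) (r : seq I) (F : I -> R -> R) :
  (forall i, continuous (F i)) ->
  int01 (fun t => \sum_(i <- r) F i t) = \sum_(i <- r) int01 (F i).
Proof.
move=> cF; elim: r => [|i r IH].
  by under [in LHS]eq_fun do rewrite big_nil; rewrite int01_cst big_nil.
under [in LHS]eq_fun do rewrite big_cons.
by rewrite int01D ?IH ?big_cons//; exact: continuous_sum.
Qed.
End UnitIntegral.

(** * Differentiation under the integral sign and Hadamard's lemma *)

Lemma differentiable_of_linear (R : realType) (V W : normedModType R)
    (f : V -> W) (z : V) (L : {linear V -> W}) : continuous L ->
  (forall e : R, 0 < e ->
    \forall h \near 0, `|f (h + z) - f z - L h| <= e * `|h|) ->
  differentiable f z /\ 'd f z = L :> (V -> W).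
Proof.
move=> cL H.
have E : f \o shift z = cst (f z) + L +o_ 0 id.
  apply/eqaddoP => e e0; apply: filterS (H e e0) => h.
  by rewrite !fctE /= opprD addrA.
have dE := diff_unique cL E.
by split=> //; apply/diff_locallyP; rewrite dE; split.
Qed.

Section Radial.
Context {R : realType} {n : nat}.
Implicit Types (f g h : 'rV[R]_n -> R) (y z v w p : 'rV[R]_n).

Lemma rV_coord_le v j : `|v ord0 j| <= `|v|.
Proof.
by rewrite [leRHS]mx_normrE; exact: (le_bigmax _ _ (ord0, j)).
Qed.

Lemma derive_coords f z v : differentiable f z ->
  'D_v f z = \sum_j v ord0 j * 'D_(delta_mx ord0 j) f z.
Proof.
move=> df; rewrite deriveE// [in LHS](row_sum_delta v) linear_sum.
by apply: eq_bigr => j _; rewrite deriveE// linearZ.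
Qed.

Lemma is_derive_line f z w (t : R) : differentiable f (z + t *: w) ->
  is_derive t 1 (fun s : R => f (z + s *: w)) ('D_w f (z + t *: w)).
Proof.
move=> df.
have dl : is_diff t (fun s : R => z + s *: w) (fun s => s *: w).
  have := @is_diffD R _ _ (cst z) (fun s : R => s *: w) _ _ t
    (is_diff_cst z t) (is_diff_scalel t w).
  by rewrite add0r.
have dfl : differentiable (f \o (fun s : R => z + s *: w)) t.
  by apply: differentiable_comp.
split; first exact/derivable1_diffP.
by rewrite (deriveE _ dfl) diff_comp//= diff_val scale1r deriveE.
Qed.

Lemma smooth_on_continuous f : smooth_on setT f -> continuous f.
Proof. by move=> sf z; exact: (sf 0%N). Qed.

Lemma bounded_on_ball (A : R) f : continuous f ->
  exists C, forall y, `|y| <= A -> `|f y| <= C.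
Proof.
(* This radius is positive whatever the sign of A. *)
move=> cf; have A1 : 0 < `|A| + 1 by rewrite ltr_wpDl.
have cb := @closed_ball_rV_compact _ _ (0 : 'rV[R]_n) _ A1.
have := compact_bounded (continuous_compact (continuous_subspaceT cf) cb).
move=> [C [_ HC]]; exists (C + 1) => y yA; apply: (HC (C + 1)).
  by rewrite ltrDl.
exists y => //; rewrite closed_ballE// /closed_ball_/= sub0r normrN.
by rewrite (le_trans yA)// (le_trans (ler_norm _))// lerDl.
Qed.

Lemma MVT_rV f y w : (forall z, differentiable f z) ->
  exists2 s : R, 0 <= s <= 1 & f (y + w) - f y = 'D_w f (y + s *: w).
Proof.
move=> df; pose l (s : R) := f (y + s *: w).
have dl (s : R) : is_derive s 1 l ('D_w f (y + s *: w)) by exact: is_derive_line.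
have cl : continuous l.
  by move=> s; apply/differentiable_continuous/derivable1_diffP; have [] := dl s.
have [s s01] := @MVT_segment R l _ 0 1 ler01 (fun s _ => dl s)
  (continuous_subspaceT cl).
by rewrite /l scale1r scale0r addr0 subr0 mulr1 => e; exists s.
Qed.

Lemma lipschitz_on_ball (A : R) f : smooth_on setT f ->
  exists2 C, 0 <= C &
    forall y w, `|y| <= A -> `|w| <= 1 -> `|f (y + w) - f y| <= C * `|w|.
Proof.
move=> sf.
(* The mean value theorem evaluates the derivative at y + s w with s and |w| at most 1, hence the
   radius A + 1. *)
have /choice[C HC] (j : 'I_n) : exists C, forall y, `|y| <= A + 1 ->
    `|'D_(delta_mx ord0 j) f y| <= C.
  exact/bounded_on_ball/smooth_on_continuous/smooth_on_derive.
exists (\sum_j `|C j|) => [|y w yA w1]; first exact: sumr_ge0.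
have [s /andP[s0 s1] ->] := MVT_rV y w (fun z => smooth_on_diff sf (I : setT z)).
rewrite derive_coords; last exact: smooth_on_diff sf _.
rewrite (le_trans (ler_norm_sum _ _ _))// mulr_suml; apply: ler_sum => j _.
rewrite normrM mulrC ler_pM// ?rV_coord_le//.
apply: le_trans (ler_norm _); apply: HC.
rewrite (le_trans (ler_normD _ _))// lerD// normrZ ger0_norm//.
by rewrite mulr_ile1.
Qed.

(** The mean value theorem expresses the increment by partial derivatives at an intermediate point,
    and these are Lipschitz. The constant is uniform in y, so the estimate can be integrated along a
    segment. *)
Lemma taylor1_on_ball (A : R) f : smooth_on setT f ->
  exists2 C, 0 <= C & forall y w, `|y| <= A -> `|w| <= 1 ->
    `|f (y + w) - f y - \sum_j w ord0 j * 'D_(delta_mx ord0 j) f y| <=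
    C * `|w| ^+ 2.
Proof.
move=> sf.
have /choice[C HC] (j : 'I_n) : exists C, 0 <= C /\ forall y w, `|y| <= A ->
    `|w| <= 1 ->
    `|'D_(delta_mx ord0 j) f (y + w) - 'D_(delta_mx ord0 j) f y| <= C * `|w|.
  have sDf := smooth_on_derive (delta_mx ord0 j) sf.
  by have [C C0 HC] := lipschitz_on_ball A sDf; exists C.
exists (\sum_j C j) => [|y w yA w1].
  by apply: sumr_ge0 => j _; have [] := HC j.
have [s /andP[s0 s1] ->] := MVT_rV y w (fun z => smooth_on_diff sf (I : setT z)).
rewrite derive_coords; last exact: smooth_on_diff sf _.
rewrite -sumrB (le_trans (ler_norm_sum _ _ _))// mulr_suml.
apply: ler_sum => j _.
have [C0 {}HC] := HC j.
rewrite -mulrBr normrM expr2 mulrCA ler_pM ?rV_coord_le//.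
have sw : `|s *: w| <= `|w| by rewrite normrZ ger0_norm// ler_piMl.
by rewrite (le_trans (HC _ _ yA _)) ?(le_trans sw)// ler_wpM2l.
Qed.

Lemma differentiable_of_quadratic f z (a : 'I_n -> R) (C : R) :
  (forall w, `|w| <= 1 ->
    `|f (z + w) - f z - \sum_j w ord0 j * a j| <= C * `|w| ^+ 2) ->
  differentiable f z /\ forall v, 'D_v f z = \sum_j v ord0 j * a j.
Proof.
move=> H.
pose L w : R := \sum_j w ord0 j * a j.
have Llin : linear L.
  move=> k u w; rewrite /L scaler_sumr -big_split; apply: eq_bigr => j _ /=.
  by rewrite !mxE mulrDl -mulrA.
pose LM := GRing.isLinear.Build _ _ _ _ _ Llin.
pose LL : {linear 'rV[R]_n -> R} := HB.pack L LM.
have cL : continuous L.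
  have sL : smooth_on setT L.
    move=> k; apply: Ck_sum => [|j _]; first exact: openT.
    by apply: (@Ck_mul _ _ _ _ (fun w => w ord0 j) (cst (a j)));
      [exact: openT|exact: smooth_on_coord|exact: Ck_cst].
  exact: smooth_on_continuous.
have C0 : 0 < `|C| + 1 by rewrite ltr_wpDl.
have [df dE] : differentiable f z /\ 'd f z = LL :> (_ -> _).
  apply: differentiable_of_linear => // e e0.
  have n1 : \forall w \near (0 : 'rV[R]_n), `|w| <= 1 := nbhs0_le ltr01.
  have n2 : \forall w \near (0 : 'rV[R]_n), `|w| <= e / (`|C| + 1).
    exact: nbhs0_le (divr_gt0 e0 C0).
  apply: filterS2 n1 n2 => w w1 w2.
  rewrite [w + z]addrC (le_trans (H w w1))// expr2 mulrA ler_wpM2r//.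
  rewrite (@le_trans _ _ ((`|C| + 1) * `|w|))//.
    by rewrite ler_wpM2r// (le_trans (ler_norm _))// lerDl.
  by rewrite mulrC -ler_pdivlMr.
by split=> // v; rewrite deriveE// dE.
Qed.

(* The factor t^m makes the family stable under derivation in z. *)
Definition radial_int (m : nat) p h z : R :=
  int01 (fun t => t ^+ m * h (p + t *: (z - p))).

Lemma radial_continuous m p h z : continuous h ->
  continuous (fun t : R => t ^+ m * h (p + t *: (z - p))).
Proof.
move=> ch; apply: continuous_mul; first exact: exprn_continuous.
move=> t; apply: (@continuous_comp _ _ _ (fun t : R => p + t *: (z - p)) h);
  last exact: ch.
by apply: cvgD; [exact: cvg_cst|exact: scalel_continuous].
Qed.

(** The Taylor estimate for h holds with one constant at all points of the segment from p to z;
    integrated over t, it leaves an error quadratic in w. *)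
Lemma radial_int_diff m p h z : smooth_on setT h ->
  differentiable (radial_int m p h) z /\
  forall v, 'D_v (radial_int m p h) z =
    \sum_j v ord0 j * radial_int m.+1 p ('D_(delta_mx ord0 j) h) z.
Proof.
move=> sh; have ch := smooth_on_continuous sh.
have cD j := smooth_on_continuous (smooth_on_derive (delta_mx ord0 j) sh).
(* This ball contains every p + t (z - p) with t in [0, 1]. *)
have [C C0 HC] := taylor1_on_ball (`|p| + `|z - p|) sh.
apply: (@differentiable_of_quadratic _ _ _ C) => w w1.
pose F j t := t ^+ m.+1 * 'D_(delta_mx ord0 j) h (p + t *: (z - p)).
(* This is t^m times the Taylor remainder of h at p + t (z - p) with increment t w; the t of the
   increment turns t^m into t^(m+1). It is spelled as a sum with coefficients -1 to match [int01D]
   and [int01Z]. *)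
pose k t := t ^+ m * h (p + t *: (z + w - p)) +
  (-1 * (t ^+ m * h (p + t *: (z - p))) + -1 * \sum_j w ord0 j * F j t).
have cF j : continuous (F j) := @radial_continuous m.+1 p _ z (cD j).
have cwF j : continuous (fun t => w ord0 j * F j t) by exact: continuous_scale.
have cS := @continuous_sum R _ (index_enum 'I_n) _ cwF.
have c1 := @radial_continuous m p _ (z + w) ch.
have c2 := @radial_continuous m p _ z ch.
have c2N := @continuous_scale R (-1) _ c2.
have cSN := @continuous_scale R (-1) _ cS.
have c3 := continuous_add c2N cSN.
have -> : radial_int m p h (z + w) - radial_int m p h z -
    \sum_j w ord0 j * radial_int m.+1 p ('D_(delta_mx ord0 j) h) z = int01 k.
  rewrite (int01D c1 c3) (int01D c2N cSN) (int01Z _ c2) (int01Z _ cS).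
  rewrite (int01_sum _ cwF) !mulN1r addrA.
  by congr (_ - _); apply: eq_bigr => j _; rewrite int01Z.
apply: int01_le => [|t /andP[t0 t1]]; first exact: continuous_add.
have -> : k t = t ^+ m * (h (p + t *: (z - p) + t *: w) - h (p + t *: (z - p)) -
    \sum_j (t *: w) ord0 j * 'D_(delta_mx ord0 j) h (p + t *: (z - p))).
  rewrite !mulrBr -[RHS]addrA /k !mulN1r; congr (_ * h _ + (_ - _)).
    by rewrite -[RHS]addrA -scalerDr addrAC.
  by rewrite mulr_sumr; apply: eq_bigr => j _; rewrite /F mxE exprS; ring.
rewrite normrM -[leRHS]mul1r ler_pM//.
  by rewrite normrX ger0_norm// exprn_ile1.
have tw : `|t *: w| <= `|w| by rewrite normrZ ger0_norm// ler_piMl.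
rewrite (le_trans (HC _ _ _ (le_trans tw w1)))//.
  by rewrite (le_trans (ler_normD _ _))// lerD2l normrZ ger0_norm// ler_piMl.
by rewrite ler_wpM2l// ler_sqr ?nnegrE.
Qed.

Lemma smooth_on_radial_int m p h : smooth_on setT h ->
  smooth_on setT (radial_int m p h).
Proof.
move=> sh k; elim: k m h sh => [|k IH] m h sh.
  by move=> z _; apply/differentiable_continuous; have [] := radial_int_diff m p z sh.
split=> [z _|v]; first by have [] := radial_int_diff m p z sh.
have -> : 'D_v (radial_int m p h) =
    fun z => \sum_j v ord0 j * radial_int m.+1 p ('D_(delta_mx ord0 j) h) z.
  by apply/funext => z; have [_ ->] := radial_int_diff m p z sh.
apply: Ck_sum => [|j _]; first exact: openT.
apply: (@Ck_mul _ _ _ _ (cst (v ord0 j))); [exact: openT|exact: Ck_cst|].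
exact/IH/smooth_on_derive.
Qed.

(** The fundamental theorem of calculus along the segment from p to z, with g_j z the integral over
    t of the j-th partial derivative of h at p + t (z - p). *)
Lemma hadamard p h : smooth_on setT h ->
  exists g : 'I_n -> 'rV[R]_n -> R,
    [/\ forall j, smooth_on setT (g j),
        forall j, g j p = 'D_(delta_mx ord0 j) h p &
        forall z, h z = h p + \sum_j (z ord0 j - p ord0 j) * g j z].
Proof.
move=> sh; exists (fun j => radial_int 0 p ('D_(delta_mx ord0 j) h)); split.
- by move=> j; exact/smooth_on_radial_int/smooth_on_derive.
- move=> j; rewrite /radial_int -[RHS]int01_cst; congr int01; apply/funext => t.
  by rewrite subrr scaler0 addr0 expr0 mul1r.
move=> z; have ch := smooth_on_continuous sh.
have cD j := smooth_on_continuous (smooth_on_derive (delta_mx ord0 j) sh).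
pose F j t := (z - p) ord0 j *
  (t ^+ 0 * 'D_(delta_mx ord0 j) h (p + t *: (z - p))).
have cF j : continuous (F j).
  by apply: continuous_scale; exact: (@radial_continuous 0 p _ z (cD j)).
have -> : \sum_j (z ord0 j - p ord0 j) *
    radial_int 0 p ('D_(delta_mx ord0 j) h) z = int01 (fun t => \sum_j F j t).
  rewrite int01_sum//; apply: eq_bigr => j _.
  by rewrite (int01Z _ (@radial_continuous 0 p _ z (cD j))) !mxE.
have dl (t : R) : is_derive t 1 (fun t => h (p + t *: (z - p))) (\sum_j F j t).
  have dh : differentiable h (p + t *: (z - p)) by exact: smooth_on_diff sh _.
  apply: (is_derive_eq (is_derive_line dh)); rewrite derive_coords//.
  by apply: eq_bigr => j _; rewrite /F expr0 mul1r.
rewrite (int01_FTC (@continuous_sum R _ _ _ cF) dl).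
by rewrite scale1r scale0r addr0 [p + _]addrC subrK [RHS]addrC subrK.
Qed.
End Radial.

(** * Coordinates of tangent vectors in a chart *)

Section CinfEval.
Context {R : realType} {n : nat} {M : manifold R n}.
Implicit Types (f g : Cinf M) (m : M).

Lemma CinfDE f g m : (f + g) m = f m + g m. Proof. by []. Qed.
Lemma CinfME f g m : (f * g) m = f m * g m. Proof. by []. Qed.
Lemma CinfZE k f m : (k *: f) m = k * f m. Proof. by []. Qed.
Lemma Cinf1E m : (1 : Cinf M) m = 1. Proof. by []. Qed.

Lemma Cinf_sumE (I : Type) (r : seq I) (F : I -> Cinf M) m :
  (\sum_(i <- r) F i) m = \sum_(i <- r) F i m.
Proof. by elim: r => [|i r IH]; rewrite ?big_nil// !big_cons CinfDE IH. Qed.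
End CinfEval.

Section Coordinates.
Context {R : realType} {n : nat} {M : manifold R n}.
Implicit Types (f g : Cinf M) (q : M).

Section Chart.
Context {c : chart n M} (ac : atlas c).

Lemma coord_extension q : chart_dom c q ->
  exists X : 'I_n -> Cinf M, forall j, \near q, X j q = c q ord0 j.
Proof.
move=> cq.
have /choice[X XE] (j : 'I_n) : exists X : Cinf M, \near q, X q = c q ord0 j.
  have sc : smooth_in (chart_dom c : set M) (fun m => c m ord0 j).
    exact: (smooth_in_chart ac (@smooth_on_coord _ _ _ j)).
  by have [X X1 _] := extension_Cinf (chart_dom_open c) cq sc; exists X.
by exists X.
Qed.

Lemma coord_vector_coord q a (X : 'I_n -> Cinf M) : chart_dom c q ->
  (forall j, \near q, X j q = c q ord0 j) ->
  forall j, coord_vector ac q a (X j) = a ord0 j.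
Proof.
move=> cq XE j; rewrite (coord_vector_local _ _ cq (XE j)).
rewrite -(derive_rV_coord (c q) a j); apply: near_eq_derive.
near=> z; rewrite /= chart_invK//; near: z; apply: open_nbhs_nbhs.
by split; [exact: chart_cod_open|exact: chart_map_cod].
Unshelve. all: by end_near. Qed.

(* Hadamard's lemma writes f, near q, as f(q) + sum_j (x_j - x_j(q)) g_j with
   g_j(q) the j-th partial derivative of f at q. *)
Lemma tangent_coords q (v : tangent q) (X : 'I_n -> Cinf M) : chart_dom c q ->
  (forall j, \near q, X j q = c q ord0 j) ->
  v = coord_vector ac q (\row_j v (X j)).
Proof.
move=> cq XE; apply: tangent_eq => f.
have ccq := chart_map_cod cq.
have [h sh hE] := extension_rV (@chart_cod_open _ _ _ c) ccq (Cinf_chart f ac).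
have [g [sg gq hg]] := hadamard (c q) sh.
have /choice[G GE] j : exists G : Cinf M, \near q, G q = g j (c q).
  have sgc : smooth_in (chart_dom c : set M) (g j \o c).
    by apply: smooth_in_chart => //; exact: smooth_on_sub (sg j).
  by have [G G1 _] := extension_Cinf (chart_dom_open c) cq sgc; exists G.
have cc : {for q, continuous c} by exact: chart_map_cont.
have hcE : \near q, h (c q) = f q.
  have hE' : \near q, h (c q) = f (chart_inv c (c q)) by exact: cc hE.
  near=> m; rewrite (near hE' m)// chart_mapK//; near: m.
  by apply: open_nbhs_nbhs; split=> //; exact: chart_dom_open.
pose F : Cinf M := f q *: (1 : Cinf M) +
    \sum_j ((- c q ord0 j) *: (1 : Cinf M) + X j) * G j.
have fF : v f = v F.
  apply: tangent_local.
  have XE' : \forall m \near q, forall j, X j m = c m ord0 j.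
    exact: filter_forall.
  have GE' : \forall m \near q, forall j, G j m = g j (c m).
    exact: filter_forall.
  near=> m; rewrite -(near hcE m)// hg (nbhs_singleton hcE).
  rewrite CinfDE CinfZE Cinf1E mulr1 Cinf_sumE; congr (_ + _).
  apply: eq_bigr => j _; rewrite CinfME CinfDE CinfZE Cinf1E mulr1.
  by rewrite (near XE' m)// (near GE' m)// [in LHS]addrC.
rewrite fF tangentD tangentZ tangent1 mulr0 add0r tangent_sum.
rewrite /= /coord_vector_fun; case: asboolP => // _.
rewrite derive_coords; last exact: Cinf_chart_diff.
(* The factor X_j - x_j(q) vanishes at q, so the Leibniz rule leaves only v (X_j) G_j(q). *)
apply: eq_bigr => j _; rewrite tangentM mxE CinfDE CinfZE Cinf1E mulr1.
rewrite (nbhs_singleton (XE j)) addNr mul0r addr0 tangentP tangent1 mulr0 add0r.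
by rewrite (nbhs_singleton (GE j)) gq (near_eq_derive _ hE).
Unshelve. all: by end_near. Qed.

(* Meaningful only when q lies in the domain of c. *)
Definition coords {q} (v : tangent q) : 'rV[R]_n :=
  get [set a | v = coord_vector ac q a].

Lemma coordsK q (v : tangent q) :
  chart_dom c q -> coord_vector ac q (coords v) = v.
Proof.
move=> cq; have [X XE] := coord_extension cq.
apply/esym/(@getI _ [set a | v = coord_vector ac q a]).
exact: tangent_coords cq XE.
Qed.

Lemma coord_vectorK q a : chart_dom c q -> coords (coord_vector ac q a) = a.
Proof.
move=> cq; have [X XE] := coord_extension cq.
apply/rowP => j; rewrite -(coord_vector_coord _ cq XE) coordsK//.
exact: coord_vector_coord.
Qed.

(** A single family X computes the coordinates at all points of a neighbourhood, which is what
    smooth dependence on the point requires. *)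
Lemma coords_local q : chart_dom c q ->
  exists (U : set M) (X : 'I_n -> Cinf M),
    [/\ open U, U q, U `<=` chart_dom c &
        forall p (v : tangent p), U p -> coords v = \row_j v (X j)].
Proof.
move=> cq; have [X XE] := coord_extension cq.
have XE' : \forall m \near q, forall j, X j m = c m ord0 j.
  exact: filter_forall.
(* The interior of A is taken because [tangent_coords] needs X_j = x_j near p, not only at p. *)
pose A := [set m | forall j, X j m = c m ord0 j].
exists (A^° `&` chart_dom c), X; split.
- by apply: openI; [exact: open_interior|exact: chart_dom_open].
- by [].
- by move=> m [].
move=> p v [Ap cp]; have XEp j : \near p, X j p = c p ord0 j.
  by apply: filterS Ap => m; exact.
by rewrite {1}(tangent_coords v cp XEp) coord_vectorK.
Qed.
End Chart.
End Coordinates.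

(** * The pullback of the tangent bundle: sections as derivations, local frames *)

Section PullbackTangent.
Context {R : realType} {n : nat} {M N : manifold R n} (phi : smooth_map M N).
Local Notation E := (pullback_bundle phi (tangent_bundle N)).
Local Notation P := (pullback phi).

(** Locally the j-th coordinate is the function m |-> v m (X_j), smooth by hypothesis. This serves
    both for the components of sections and for transition matrices. *)
Lemma smooth_in_coords (c : chart n N) (ac : atlas c) (U : set M)
    (v : forall m, tangent (phi m)) :
  (forall m, U m -> chart_dom c (phi m)) ->
  (forall f : Cinf N, smooth_in U (fun m => v m f)) -> open U ->
  forall j, smooth_in U (fun m => coords ac (v m) ord0 j).
Proof.
move=> Uc sv oU j; apply: smooth_in_local => m Um.
have [V [X [oV Vm Vc XE]]] := coords_local ac (Uc m Um).
have oW : open (U `&` phi @^-1` V).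
  by apply: openI => //; exact: smooth_map_preim_open.
exists (U `&` phi @^-1` V) => //.
apply: (@smooth_in_eq _ _ _ _ (fun m => v m (X j))) => //.
  by move=> w [_ Vw]; rewrite XE// mxE.
by apply: smooth_in_sub (sv (X j)) => w [].
Qed.

(** Since P g m = g (phi m), evaluating D at m gives a derivation at phi m; the resulting section is
    smooth because every D f is. *)
Lemma section_of_derivation (D : Cinf N -> Cinf M) :
  (forall k f g, D (k *: f + g) = k *: D f + D g) ->
  (forall f g, D (f * g) = D f * P g + P f * D g) ->
  exists x : Gamma E, act x = D.
Proof.
move=> Dl DM.
have Dt m : (fun f => D f m) \in is_derivation_at (phi m).
  by apply/asboolP; split=> [k f g|f g]; rewrite ?Dl ?DM.
pose v m : tangent (phi m) := Tangent (Dt m).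
have sv e : frames E e -> exists a : M -> 'rV[R]_(rank E),
    (forall j, smooth_in (frame_dom e) (fun m => a m ord0 j)) /\
    (forall m, frame_dom e m -> v m = e m (a m)).
  move=> [_ [c [ac ->]] <-]; exists (fun m => coords ac (v m)); split=> [j|m cm].
    apply: smooth_in_coords => //;
      last exact: smooth_map_preim_open (chart_dom_open c).
    by move=> f; apply: smooth_in_sub (Cinf_smooth (D f)).
  by rewrite /= coordsK.
by exists (MkGamma sv); apply/funext => f; exact: Cinf_eq.
Qed.

Lemma pullback_frame_transition e e' : frames E e -> frames E e' ->
  exists G : M -> 'M[R]_n,
    (forall i j, smooth_in (frame_dom e `&` frame_dom e') (fun m => G m i j)) /\
    (forall m, frame_dom e m -> frame_dom e' m ->
       forall a, e m a = e' m (a *m G m)).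
Proof.
move=> [_ [c [ac ->]] <-] [_ [c' [ac' ->]] <-].
(* Row i holds the c'-coordinates of the i-th coordinate vector of c. *)
exists (fun m =>
  \matrix_i coords ac' (coord_vector ac (phi m) (delta_mx ord0 i))).
split=> [i j|m cm c'm a] /=; last first.
  rewrite mulmx_sum_row [in LHS](row_sum_delta a) !linear_sum.
  by apply: eq_bigr => i _; rewrite !linearZ /= rowK coordsK.
set U := (_ `&` _).
have oU : open U by apply: openI; exact: smooth_map_preim_open (chart_dom_open _).
apply: (@smooth_in_eq _ _ _ _ (fun m =>
  coords ac' (coord_vector ac (phi m) (delta_mx ord0 i)) ord0 j)) => //.
  by move=> m _; rewrite mxE.
apply: smooth_in_coords => //; first by move=> m [].
(* Applied to f, the coordinate vectors of c give the i-th partial derivative of f in c, composed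
   with phi. *)
move=> f; apply: (@smooth_in_sub _ _ _ _ (phi @^-1` chart_dom c)).
  by move=> m [].
apply: (@smooth_in_eq _ _ _ _
    (('D_(delta_mx ord0 i) (f \o chart_inv c) \o c) \o phi)).
- exact: smooth_map_preim_open (chart_dom_open c).
- by move=> m cm; rewrite /= /coord_vector_fun; case: asboolP.
- apply: smooth_in_comp; first exact: chart_dom_open.
  exact/(smooth_in_chart ac)/smooth_on_derive/Cinf_chart.
Qed.

Lemma pullback_tangent_vector_bundle : is_vector_bundle E.
Proof.
split; last exact: pullback_frame_transition.
- move=> m; have [c ac cm] := atlas_cover (phi m).
  exists (pullback_frame phi (coord_frame ac)) => //.
  by exists (coord_frame ac) => //; exists c, ac.
- move=> _ [_ [c [ac ->]] <-] m cm.
  by exists (coords ac) => [a|v] /=; [exact: coord_vectorK|exact: coordsK].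
Qed.

Section Action.
Implicit Types (x y : Gamma E) (f g : Cinf N) (h : Cinf M).

Lemma actE x f m : act x f m = (x m : tangent (phi m)) f. Proof. by []. Qed.

Lemma act_linear x k f g : act x (k *: f + g) = k *: act x f + act x g.
Proof. by apply: Cinf_eq => m; rewrite CinfDE CinfZE !actE tangentP. Qed.

Lemma actM x f g : act x (f * g) = act x f * P g + P f * act x g.
Proof. by apply: Cinf_eq => m; rewrite CinfDE !CinfME !actE tangentM. Qed.

Lemma actD x f g : act x (f + g) = act x f + act x g.
Proof. by apply: Cinf_eq => m; rewrite CinfDE !actE tangentD. Qed.

Lemma actB x f g : act x (f - g) = act x f - act x g.
Proof. by rewrite -scaleN1r addrC act_linear scaleN1r addrC. Qed.

Lemma actPl x y k f : act (k *: x + y) f = k *: act x f + act y f.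
Proof.
by apply: Cinf_eq => m; rewrite CinfDE CinfZE !actE GammaDE GammaZE.
Qed.

Lemma actDl x y f : act (x + y) f = act x f + act y f.
Proof. by apply: Cinf_eq => m; rewrite CinfDE !actE GammaDE. Qed.

Lemma actNl x f : act (- x) f = - act x f.
Proof. by apply: Cinf_eq => m; rewrite !actE GammaNE. Qed.

Lemma act_Cscale h x f : act (Cscale h x) f = h * act x f.
Proof. by apply: Cinf_eq => m; rewrite CinfME !actE CscaleE. Qed.
End Action.

Lemma pullback_linear k f g : P (k *: f + g) = k *: P f + P g.
Proof. exact: Cinf_eq. Qed.

Lemma pullbackD f g : P (f + g) = P f + P g.
Proof. exact: Cinf_eq. Qed.

Lemma pullbackB f g : P (f - g) = P f - P g.
Proof. exact: Cinf_eq. Qed.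

Lemma pullbackM f g : P (f * g) = P f * P g.
Proof. exact: Cinf_eq. Qed.
End PullbackTangent.

(** * The Hom-Lie algebroid structure *)

Section HomLieAlgebroid.
Context {R : realType} {n : nat} {M : manifold R n} (phi : diffeo M M).
Local Notation E := (pullback_bundle phi (tangent_bundle M)).
Local Notation P := (pullback phi).
Local Notation Q := (pullback (diffeo_inv phi)).
Implicit Types (x y z : Gamma E) (f g : Cinf M).

Lemma pullback_diffeoK : cancel P Q.
Proof. by move=> f; apply: Cinf_eq => m /=; rewrite diffeo_invK. Qed.

Lemma pullback_diffeo_invK : cancel Q P.
Proof. by move=> f; apply: Cinf_eq => m /=; rewrite diffeo_mapK. Qed.

(** As P Q = 1, the Leibniz rule for x reads x (Q f Q g) = x (Q f) g + f x (Q g); applying the ring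
    morphism P gives the rule for P x Q. *)
Lemma exists_Ad x : exists y, act y = P \o act x \o Q.
Proof.
apply: section_of_derivation => [k f g|f g] /=.
  by rewrite !(pullback_linear, act_linear).
by rewrite pullbackM actM !pullback_diffeo_invK pullbackD !pullbackM.
Qed.

Lemma exists_bracket x y : exists z, act z =
  (P \o act x \o Q \o act y \o Q) \- (P \o act y \o Q \o act x \o Q).
Proof.
apply: section_of_derivation => [k f g|f g] /=.
  rewrite !(pullback_linear, act_linear) scalerBr.
  by rewrite opprD addrACA.
(* Besides the Leibniz terms, each composite yields the cross terms P (x (Q f) y (Q g) + y (Q f) x
   (Q g)); they are symmetric in x and y and cancel in the difference. *)
rewrite !(pullbackM, actM, pullback_diffeo_invK, pullbackD, actD).
by ring.
Qed.
Lemma pullback_tangent_hom_lie_algebroid :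
  exists (Ad : Gamma E -> Gamma E) (br : Gamma E -> Gamma E -> Gamma E),
    [/\ forall x, act (Ad x) = P \o act x \o Q,
        forall x y, act (br x y) =
          (P \o act x \o Q \o act y \o Q) \-
          (P \o act y \o Q \o act x \o Q) &
        is_hom_lie_algebroid (phi := phi) Ad br
          (fun m => idfun : {linear E m -> E m})].
Proof.
have /choice[Ad AdE] := exists_Ad.
have /choice[b bE] := fun xy : Gamma E * Gamma E => exists_bracket xy.1 xy.2.
exists Ad, (fun x y => b (x, y)).
have {}bE x y : act (b (x, y)) = (P \o act x \o Q \o act y \o Q) \-
  (P \o act y \o Q \o act x \o Q) by rewrite bE.
have AdE' x f : act (Ad x) f = P (act x (Q f)) by rewrite AdE.
have bE' x y f : act (b (x, y)) f =
    P (act x (Q (act y (Q f)))) - P (act y (Q (act x (Q f)))) by rewrite bE.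
have PK : cancel P Q := pullback_diffeoK.
have QK : cancel Q P := pullback_diffeo_invK.
have Ad_lin : linear Ad.
  move=> k x y; apply: act_inj; apply/funext => f.
  by rewrite AdE' !actPl pullback_linear !AdE'.
split=> //; split.
- split=> //; first exact: pullback_tangent_vector_bundle.
  move=> f x; apply: act_inj; apply/funext => g.
  by rewrite AdE' !act_Cscale pullbackM AdE'.
- split=> //.
  + move=> y k x x'; apply: act_inj; apply/funext => f.
    rewrite bE' !actPl !(pullback_linear, act_linear) !bE'.
    by rewrite scalerBr opprD addrACA.
  + move=> x k y y'; apply: act_inj; apply/funext => f.
    rewrite bE' !actPl !(pullback_linear, act_linear) !bE'.
    by rewrite scalerBr opprD addrACA.
  + move=> x y; apply: act_inj; apply/funext => f.
    by rewrite actNl !bE' opprB.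
  + move=> x y; apply: act_inj; apply/funext => f.
    by rewrite AdE' !bE' !AdE' !pullbackB !PK.
  (* Once Q P is cancelled, each term is, up to sign, P P a Q b Q c Q Q f with a, b, c a permutation
     of x, y, z. The twelve terms cancel in pairs, as for commutators. *)
  + move=> x y z; apply: act_inj; apply/funext => f.
    rewrite !actDl !(bE', AdE', pullbackB, actB, PK).
    have -> : act (0 : Gamma E) f = 0 by apply: Cinf_eq.
    by ring.
(* In a pair of frames the identity map has the transition matrix as its matrix. *)
- move=> e e'; exact: pullback_frame_transition.
- exists act; split=> //.
  (* In x (Q f y' (Q g)) with y' = Q y, the Leibniz rule produces the term where x differentiates Q
     f; P sends it to the product of Ad x (f) and Ad y (g), the anchor term. *)
  + move=> x y f; apply: act_inj; apply/funext => g.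
    rewrite actDl !act_Cscale !bE' !act_Cscale !AdE'.
    rewrite !(pullbackM, actM, QK, pullbackD).
    by ring.
  + split=> //.
    * by move=> k f g; rewrite pullback_linear.
    * by move=> x k f g; rewrite act_linear.
    * by move=> f k x y; rewrite actPl.
    * by move=> x f /=; rewrite AdE' PK.
    * by move=> x y f /=; rewrite bE' !AdE' PK.
Qed.
End HomLieAlgebroid.

Theorem proposition3p9 (R : realType) (n : nat) (M : manifold R n)
    (phi : diffeo M M) :
  let E := pullback_bundle phi (tangent_bundle M) in
  let P := pullback phi in
  let Pinv := pullback (diffeo_inv phi) in
  exists (Ad : Gamma E -> Gamma E) (br : Gamma E -> Gamma E -> Gamma E),
    [/\ forall x, act (Ad x) = P \o act x \o Pinv,
        forall x y, act (br x y) =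
          (P \o act x \o Pinv \o act y \o Pinv) \-
          (P \o act y \o Pinv \o act x \o Pinv) &
        is_hom_lie_algebroid (phi := phi) Ad br
          (fun m => idfun : {linear E m -> E m})].
Proof. exact: pullback_tangent_hom_lie_algebroid. Qed.
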